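(* Let $\mathbb{K}$ be a field of characteristic zero and $\hbar$ a formal parameter. Let $\mathcal{C},\mathcal{B}$ be ($\mathbb{K}$-linear) symmetric pre-Cartier categories, each of whose infinitesimal braidings $t$ satisfies, for all objects $X,Y,Z$, $$[\,t_{X,Y}\otimes\mathrm{id}_Z,\ \mathrm{id}_X\otimes t_{Y,Z}\,]=0\qquad\text{and}\qquad t_{Y,X}\circ\sigma_{X,Y}=-\sigma_{X,Y}\circ t_{X,Y}.$$ Let $(F,F^2,F^0):\mathcal{C}\to\mathcal{B}$ be an infinitesimally braided comonoidal functor, let $(\hat F,\hat F^2,\hat F^0):\hat{\mathcal{C}}\to\hat{\mathcal{B}}$ be its extension to the deformed categories, and let $A^0$ be the class of all $F$-adapted infinitesimally cocommutative comonoids in $\mathcal{C}$. For any $(x,\Delta_x,\varepsilon_x)$, $(y,\Delta_y,\varepsilon_y)$, $(z,\Delta_z,\varepsilon_z)$ in $A^0$ set $A_{x,y}:=\hat F(x\otimes y)$ and \begin{align*} \Delta_{x,y}&=\hat F^2(x\otimes y,x\otimes y)\circ\hat F(\mathrm{id}_x\otimes\hat\sigma_{x,y}\otimes\mathrm{id}_y)\circ\hat F(\Delta_x\otimes\Delta_y),\\ \varepsilon_{x,y}&=\hat F^0\circ\hat F(\varepsilon_x\otimes\varepsilon_y),\\ m_{x,y,z}&=\hat F(\mathrm{id}_x\otimes\varepsilon_y\otimes\mathrm{id}_z)\circ(\gamma^y_{x,z})^{-1},\\ u_x&=\hat F(\Delta_x)\circ(\chi_x)^{-1},\\ S_{x,y}&=\hat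 F(\hat\sigma_{x,y}). \end{align*} Then $(A^0,A^1=\{A_{x,y}\},m=\{m_{x,y,z}\},u=\{u_x\},S=\{S_{x,y}\})$, where each $A_{x,y}$ carries the comultiplication $\Delta_{x,y}$ and the counit $\varepsilon_{x,y}$, is a Hopf $\hat{\mathcal{B}}$-category.
   Context: Conventions. All monoidal categories are strict and $\mathbb{K}$-linear (with $\mathbb{K}$-bilinear tensor product), and functors between them are $\mathbb{K}$-linear; tensor product, unit and braiding are denoted $\otimes,I,\sigma$ in every category. Comonoids. A comonoid is a triple $(M,\Delta,\varepsilon)$ with $\Delta:M\to M\otimes M$, $\varepsilon:M\to I$, $(\mathrm{id}\otimes\Delta)\circ\Delta=(\Delta\otimes\mathrm{id})\circ\Delta$, $(\varepsilon\otimes\mathrm{id})\circ\Delta=\mathrm{id}=(\mathrm{id}\otimes\varepsilon)\circ\Delta$. A morphism of comonoids $f:M\to M'$ satisfies $(f\otimes f)\circ\Delta=\Delta'\circ f$ and $\varepsilon'\circ f=\varepsilon$. In a symmetric monoidal category, $M\otimes M'$ is a comonoid with comultiplication $(\mathrm{id}\otimes\sigma\otimes\mathrm{id})\circ(\Delta\otimes\Delta')$ and counit $\varepsilon\otimes\varepsilon'$, and $I$ is trivially a comonoid; comonoids form a symmetric monoidal category $\mathrm{Com}(\cdot)$. Pre-Cartier categories. A braided monoidal category is pre-Cartier if it has a natural transformation $t:\otimes\Rightarrow\otimes$ (infinitesimal braiding), $t_{X,Y}:X\otimes Y\to X\otimes Y$, with $t_{X,Y\otimes Z}=t_{X,Y}\otimes\mathrm{id}_Z+(\sigma_{X,Y}^{-1}\otimes\mathrm{id}_Z)\circ(\mathrm{id}_Y\otimes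 t_{X,Z})\circ(\sigma_{X,Y}\otimes\mathrm{id}_Z)$ and $t_{X\otimes Y,Z}=\mathrm{id}_X\otimes t_{Y,Z}+(\mathrm{id}_X\otimes\sigma_{Y,Z}^{-1})\circ(t_{X,Z}\otimes\mathrm{id}_Y)\circ(\mathrm{id}_X\otimes\sigma_{Y,Z})$. It is a symmetric pre-Cartier category if the underlying braided category is symmetric. A comonoid $(M,\Delta,\varepsilon)$ in a pre-Cartier category is infinitesimally cocommutative if $\sigma_{M,M}\circ\Delta=\Delta$ and $t_{M,M}\circ\Delta=0$. Functors. A braided comonoidal functor $(F,F^2,F^0):\mathcal{C}\to\mathcal{B}$ is a functor $F$ with a morphism $F^0:F(I)\to I$ and a natural transformation $F^2(X,Y):F(X\otimes Y)\to F(X)\otimes F(Y)$ such that $(\mathrm{id}\otimes F^2(Y,Z))\circ F^2(X,Y\otimes Z)=(F^2(X,Y)\otimes\mathrm{id})\circ F^2(X\otimes Y,Z)$, $\sigma_{F(X),F(Y)}\circ F^2(X,Y)=F^2(Y,X)\circ F(\sigma_{X,Y})$, $(F^0\otimes\mathrm{id})\circ F^2(I,X)=\mathrm{id}$, $(\mathrm{id}\otimes F^0)\circ F^2(X,I)=\mathrm{id}$. It is infinitesimally braided if moreover $F^2(X,Y)\circ F(t_{X,Y})=t_{F(X),F(Y)}\circ F^2(X,Y)$ for all $X,Y$. A comonoid $(M,\Delta,\varepsilon)$ in $\mathcal{C}$ is $F$-adapted if for all objects $X,Y$ the morphisms $F^0\circ F(\varepsilon):F(M)\to I$ and $F^2(X\otimes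 M,M\otimes Y)\circ F(\mathrm{id}_X\otimes\Delta\otimes\mathrm{id}_Y):F(X\otimes M\otimes Y)\to F(X\otimes M)\otimes F(M\otimes Y)$ are invertible. Deformation. Under the two displayed conditions on $t$, $\hat{\mathcal{C}}$ is the symmetric monoidal category with the objects of $\mathcal{C}$, morphism spaces $\mathrm{Hom}_{\mathcal{C}}(X,Y)[[\hbar]]$, composition and tensor product extended $\hbar$-linearly, and braiding $\hat\sigma_{X,Y}=\tilde\sigma_{X,Y}\circ e^{\hbar t_{X,Y}}$, where $\tilde\sigma$ is the $\hbar$-linear extension of $\sigma$; similarly $\hat{\mathcal{B}}$. The deformed braided comonoidal functor $(\hat F,\hat F^2,\hat F^0)$ is the $\hbar$-linear extension: $\hat F=F$ on objects, $\hat F$ is $F$ applied coefficientwise on morphisms, $\hat F^2=F^2$, $\hat F^0=F^0$. Here $\chi_x:=\hat F^0\circ\hat F(\varepsilon_x)$ and $\gamma^y_{x,z}:=\hat F^2(x\otimes y,y\otimes z)\circ\hat F(\mathrm{id}_x\otimes\Delta_y\otimes\mathrm{id}_z):\hat F(x\otimes y\otimes z)\to\hat F(x\otimes y)\otimes\hat F(y\otimes z)$. Hopf categories. For a symmetric monoidal category $\mathcal{V}$, a $\mathcal{V}$-category $(A^0,A^1,m,u)$ consists of a class $A^0$, objects $A_{x,y}$ of $\mathcal{V}$ for $x,y\in A^0$, morphisms $m_{x,y,z}:A_{x,y}\otimes A_{y,z}\to A_{x,z}$ and $u_x:I\to A_{x,x}$ with $m_{x,z,w}\circ(m_{x,y,z}\otimes\mathrm{id})=m_{x,y,w}\circ(\mathrm{id}\otimes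 m_{y,z,w})$ and $m_{x,x,y}\circ(u_x\otimes\mathrm{id})=\mathrm{id}=m_{x,y,y}\circ(\mathrm{id}\otimes u_y)$. A Hopf $\mathcal{V}$-category is a $\mathrm{Com}(\mathcal{V})$-category (each $A_{x,y}$ is a comonoid $(A_{x,y},\Delta_{x,y},\varepsilon_{x,y})$ in $\mathcal{V}$ and all $m_{x,y,z},u_x$ are comonoid morphisms) together with morphisms $S_{x,y}:A_{x,y}\to A_{y,x}$ in $\mathcal{V}$ with $m_{x,y,x}\circ(\mathrm{id}\otimes S_{x,y})\circ\Delta_{x,y}=u_x\circ\varepsilon_{x,y}$ and $m_{y,x,y}\circ(S_{x,y}\otimes\mathrm{id})\circ\Delta_{x,y}=u_y\circ\varepsilon_{x,y}$. *)

(* Defs.v *)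
From mathcomp Require Import all_boot all_algebra.
From mathcomp Require Import boolp classical_sets functions.

Set Implicit Arguments.
Unset Strict Implicit.
Unset Printing Implicit Defensive.

Import GRing.Theory.
Local Open Scope ring_scope.

Declare Scope lcat_scope.
Delimit Scope lcat_scope with lcat.
Local Open Scope lcat_scope.

Reserved Notation "X ~> Y" (at level 70, no associativity).
Reserved Notation "X ⊗ Y" (at level 38, left associativity).
Reserved Notation "f ⊠ g" (at level 38, left associativity).
Reserved Notation "g ∘ f" (at level 39, left associativity).

Record linCat (K : fieldType) := LinCat {
  obj :> Type;
  mhom : obj -> obj -> lmodType K;
  idm : forall X, mhom X X;
  mcomp : forall X Y Z, mhom Y Z -> mhom X Y -> mhom X Z;
  mcompA : forall X Y Z W (h : mhom Z W) (g : mhom Y Z) (f : mhom X Y),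
    mcomp h (mcomp g f) = mcomp (mcomp h g) f;
  mcomp1m : forall X Y (f : mhom X Y), mcomp (idm Y) f = f;
  mcompm1 : forall X Y (f : mhom X Y), mcomp f (idm X) = f;
  mcomp_linl : forall X Y Z (a : K) (g g' : mhom Y Z) (f : mhom X Y),
    mcomp (a *: g + g') f = a *: mcomp g f + mcomp g' f;
  mcomp_linr : forall X Y Z (a : K) (g : mhom Y Z) (f f' : mhom X Y),
    mcomp g (a *: f + f') = a *: mcomp g f + mcomp g f' }.

Arguments mhom {K l}.
Arguments idm {K l} X.
Arguments mcomp {K l X Y Z}.

Notation "X ~> Y" := (mhom X Y) : lcat_scope.
Notation "g ∘ f" := (mcomp g f) : lcat_scope.

(* The identity morphism of X, viewed as a morphism X ~> Y along X = Y.  It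
   makes the identifications of a strict monoidal category explicit; by proof
   irrelevance it does not depend on the chosen proof of X = Y. *)
Definition idto K (C : linCat K) (X Y : C) (e : X = Y) : X ~> Y :=
  match e in _ = Y' return X ~> Y' with erefl => idm X end.

Definition is_inverse K (C : linCat K) (X Y : C) (f : X ~> Y) (g : Y ~> X) :=
  g ∘ f = idm X /\ f ∘ g = idm Y.

Definition invertible K (C : linCat K) (X Y : C) (f : X ~> Y) :=
  exists g, is_inverse f g.

(* The unique two-sided inverse of f if f is invertible, and 0 otherwise. *)
Definition minv K (C : linCat K) (X Y : C) (f : X ~> Y) : Y ~> X :=
  xget 0 [set g | is_inverse f g].

(* Strictness is expressed by tensA, tens1X and tensX1, equalities of objects,
   together with the corresponding equalities of morphisms tensmA, tens1m and
   tensm1 along the identity morphisms idto. *)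
Record monCat (K : fieldType) := MonCat {
  mon_cat :> linCat K;
  tens : mon_cat -> mon_cat -> mon_cat;
  munit : mon_cat;
  tensm : forall X X' Y Y' : mon_cat,
    X ~> X' -> Y ~> Y' -> tens X Y ~> tens X' Y';
  tensm_id : forall X Y, tensm (idm X) (idm Y) = idm (tens X Y);
  tensm_comp : forall (X X' X'' Y Y' Y'' : mon_cat)
    (f' : X' ~> X'') (f : X ~> X') (g' : Y' ~> Y'') (g : Y ~> Y'),
    tensm (f' ∘ f) (g' ∘ g) = tensm f' g' ∘ tensm f g;
  tensm_linl : forall (X X' Y Y' : mon_cat) (a : K)
    (f f' : X ~> X') (g : Y ~> Y'),
    tensm (a *: f + f') g = a *: tensm f g + tensm f' g;
  tensm_linr : forall (X X' Y Y' : mon_cat) (a : K)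
    (f : X ~> X') (g g' : Y ~> Y'),
    tensm f (a *: g + g') = a *: tensm f g + tensm f g';
  tensA : forall X Y Z, tens X (tens Y Z) = tens (tens X Y) Z;
  tens1X : forall X, tens munit X = X;
  tensX1 : forall X, tens X munit = X;
  tensmA : forall (X X' Y Y' Z Z' : mon_cat)
    (f : X ~> X') (g : Y ~> Y') (h : Z ~> Z'),
    idto (tensA X' Y' Z') ∘ tensm f (tensm g h)
      = tensm (tensm f g) h ∘ idto (tensA X Y Z);
  tens1m : forall (X X' : mon_cat) (f : X ~> X'),
    idto (tens1X X') ∘ tensm (idm munit) f = f ∘ idto (tens1X X);
  tensm1 : forall (X X' : mon_cat) (f : X ~> X'),
    idto (tensX1 X') ∘ tensm f (idm munit) = f ∘ idto (tensX1 X) }.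

Arguments tens {K m}.
Arguments munit {K m}.
Arguments tensm {K m X X' Y Y'}.
Arguments tensA {K m}.
Arguments tens1X {K m}.
Arguments tensX1 {K m}.

Notation "X ⊗ Y" := (tens X Y) : lcat_scope.
Notation "f ⊠ g" := (tensm f g) : lcat_scope.

Section Strict.
Context {K : fieldType} {C : monCat K}.
Implicit Types X Y Z M N : C.

Definition assoc X Y Z : X ⊗ (Y ⊗ Z) ~> (X ⊗ Y) ⊗ Z := idto (tensA X Y Z).
Definition assocV X Y Z : (X ⊗ Y) ⊗ Z ~> X ⊗ (Y ⊗ Z) :=
  idto (esym (tensA X Y Z)).
Definition lunit X : munit ⊗ X ~> X := idto (tens1X X).
Definition lunitV X : X ~> munit ⊗ X := idto (esym (tens1X X)).
Definition runit X : X ⊗ munit ~> X := idto (tensX1 X).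
Definition runitV X : X ~> X ⊗ munit := idto (esym (tensX1 X)).

Fact tens_XMMY X M Y : (X ⊗ (M ⊗ M)) ⊗ Y = (X ⊗ M) ⊗ (M ⊗ Y).
Proof. by rewrite !tensA. Qed.

Fact tens_X1Y X Y : (X ⊗ munit) ⊗ Y = X ⊗ Y.
Proof. by rewrite tensX1. Qed.

Fact tens_MMNN M N : (M ⊗ M) ⊗ (N ⊗ N) = (M ⊗ (M ⊗ N)) ⊗ N.
Proof. by rewrite !tensA. Qed.

Fact tens_MNMN M N : (M ⊗ (N ⊗ M)) ⊗ N = (M ⊗ N) ⊗ (M ⊗ N).
Proof. by rewrite !tensA. Qed.

(* Triple products X ⊗ M ⊗ Y are bracketed to the left: id_comul_id is
   id_X ⊗ Delta ⊗ id_Y and id_counit_id is id_X ⊗ eps ⊗ id_Y, up to the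
   identification of their codomains. *)
Definition id_comul_id X M (Delta : M ~> M ⊗ M) Y :
    (X ⊗ M) ⊗ Y ~> (X ⊗ M) ⊗ (M ⊗ Y) :=
  idto (tens_XMMY X M Y) ∘ ((idm X ⊠ Delta) ⊠ idm Y).

Definition id_counit_id X M (eps : M ~> munit) Y : (X ⊗ M) ⊗ Y ~> X ⊗ Y :=
  idto (tens_X1Y X Y) ∘ ((idm X ⊠ eps) ⊠ idm Y).

Definition is_comonoid M (Delta : M ~> M ⊗ M) (eps : M ~> munit) : Prop :=
  [/\ assoc M M M ∘ (idm M ⊠ Delta) ∘ Delta = (Delta ⊠ idm M) ∘ Delta,
      lunit M ∘ (eps ⊠ idm M) ∘ Delta = idm M
    & runit M ∘ (idm M ⊠ eps) ∘ Delta = idm M].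

Definition is_comonoid_morphism
    M (Delta : M ~> M ⊗ M) (eps : M ~> munit)
    N (Delta' : N ~> N ⊗ N) (eps' : N ~> munit) (f : M ~> N) : Prop :=
  (f ⊠ f) ∘ Delta = Delta' ∘ f /\ eps' ∘ f = eps.

End Strict.

Record comonoid K (C : monCat K) := Comonoid {
  com_obj :> C;
  comul : com_obj ~> com_obj ⊗ com_obj;
  counit : com_obj ~> munit;
  comonoidP : is_comonoid comul counit }.

Arguments comul {K C} c.
Arguments counit {K C} c.

Record braidedCat (K : fieldType) := BraidedCat {
  br_mon :> monCat K;
  braid : forall X Y : br_mon, X ⊗ Y ~> Y ⊗ X;
  braidV : forall X Y : br_mon, Y ⊗ X ~> X ⊗ Y;
  braidK : forall X Y, is_inverse (braid X Y) (braidV X Y);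
  braid_nat : forall (X X' Y Y' : br_mon) (f : X ~> X') (g : Y ~> Y'),
    (g ⊠ f) ∘ braid X Y = braid X' Y' ∘ (f ⊠ g);
  braid_hexr : forall X Y Z : br_mon,
    braid X (Y ⊗ Z) =
      assoc Y Z X ∘ (idm Y ⊠ braid X Z) ∘ assocV Y X Z
        ∘ (braid X Y ⊠ idm Z) ∘ assoc X Y Z;
  braid_hexl : forall X Y Z : br_mon,
    braid (X ⊗ Y) Z =
      assocV Z X Y ∘ (braid X Z ⊠ idm Y) ∘ assoc X Z Y
        ∘ (idm X ⊠ braid Y Z) ∘ assocV X Y Z }.

Arguments braid {K b}.
Arguments braidV {K b}.

Definition is_symmetric K (C : braidedCat K) : Prop :=
  forall X Y : C, braid Y X ∘ braid X Y = idm (X ⊗ Y).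

Record symCat (K : fieldType) := SymCat {
  sym_br :> braidedCat K;
  symP : is_symmetric sym_br }.

Record preCartier (K : fieldType) := PreCartier {
  pc_br :> braidedCat K;
  infbr : forall X Y : pc_br, X ⊗ Y ~> X ⊗ Y;
  infbr_nat : forall (X X' Y Y' : pc_br) (f : X ~> X') (g : Y ~> Y'),
    (f ⊠ g) ∘ infbr X Y = infbr X' Y' ∘ (f ⊠ g);
  infbr_hexr : forall X Y Z : pc_br,
    infbr X (Y ⊗ Z) =
      assocV X Y Z
        ∘ (infbr X Y ⊠ idm Z
           + (braidV X Y ⊠ idm Z) ∘ assoc Y X Z ∘ (idm Y ⊠ infbr X Z)
               ∘ assocV Y X Z ∘ (braid X Y ⊠ idm Z))
        ∘ assoc X Y Z;
  infbr_hexl : forall X Y Z : pc_br,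
    infbr (X ⊗ Y) Z =
      assoc X Y Z
        ∘ (idm X ⊠ infbr Y Z
           + (idm X ⊠ braidV Y Z) ∘ assocV X Z Y ∘ (infbr X Z ⊠ idm Y)
               ∘ assoc X Z Y ∘ (idm X ⊠ braid Y Z))
        ∘ assocV X Y Z }.

Arguments infbr {K p}.

Record symPreCartier (K : fieldType) := SymPreCartier {
  spc_pc :> preCartier K;
  spc_symP : is_symmetric spc_pc }.

(* [t_{X,Y} ⊗ id_Z, id_X ⊗ t_{Y,Z}] = 0 as endomorphisms of (X ⊗ Y) ⊗ Z. *)
Definition infbr_commutes K (C : preCartier K) : Prop :=
  forall X Y Z : C,
    let f := infbr X Y ⊠ idm Z in
    let g := assoc X Y Z ∘ (idm X ⊠ infbr Y Z) ∘ assocV X Y Z in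
    f ∘ g - g ∘ f = 0.

Definition infbr_skew K (C : preCartier K) : Prop :=
  forall X Y : C, infbr Y X ∘ braid X Y = - (braid X Y ∘ infbr X Y).

Definition inf_cocommutative K (C : preCartier K) (M : comonoid C) : Prop :=
  braid M M ∘ comul M = comul M /\ infbr M M ∘ comul M = 0.

Record brComonFunctor K (C B : braidedCat K) := BrComonFunctor {
  fobj :> C -> B;
  fmor : forall X Y : C, X ~> Y -> fobj X ~> fobj Y;
  fmor_id : forall X, fmor (idm X) = idm (fobj X);
  fmor_comp : forall (X Y Z : C) (g : Y ~> Z) (f : X ~> Y),
    fmor (g ∘ f) = fmor g ∘ fmor f;
  fmor_lin : forall (X Y : C) (a : K) (f g : X ~> Y),
    fmor (a *: f + g) = a *: fmor f + fmor g;
  F0 : fobj munit ~> munit;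
  F2 : forall X Y : C, fobj (X ⊗ Y) ~> fobj X ⊗ fobj Y;
  F2_nat : forall (X X' Y Y' : C) (f : X ~> X') (g : Y ~> Y'),
    F2 X' Y' ∘ fmor (f ⊠ g) = (fmor f ⊠ fmor g) ∘ F2 X Y;
  F2_coassoc : forall X Y Z : C,
    assoc (fobj X) (fobj Y) (fobj Z)
        ∘ (idm (fobj X) ⊠ F2 Y Z) ∘ F2 X (Y ⊗ Z)
      = (F2 X Y ⊠ idm (fobj Z)) ∘ F2 (X ⊗ Y) Z ∘ fmor (assoc X Y Z);
  F2_braid : forall X Y : C,
    braid (fobj X) (fobj Y) ∘ F2 X Y = F2 Y X ∘ fmor (braid X Y);
  F2_counitl : forall X : C,
    lunit (fobj X) ∘ (F0 ⊠ idm (fobj X)) ∘ F2 munit X = fmor (lunit X);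
  F2_counitr : forall X : C,
    runit (fobj X) ∘ (idm (fobj X) ⊠ F0) ∘ F2 X munit = fmor (runit X) }.

Arguments fmor {K C B} b {X Y}.
Arguments F0 {K C B} b.
Arguments F2 {K C B} b.

Definition inf_braided K (C B : preCartier K) (F : brComonFunctor C B) : Prop :=
  forall X Y : C,
    F2 F X Y ∘ fmor F (infbr X Y) = infbr (F X) (F Y) ∘ F2 F X Y.

Definition chi K (C B : braidedCat K) (F : brComonFunctor C B)
    (M : comonoid C) : F M ~> munit :=
  F0 F ∘ fmor F (counit M).

Definition gamma K (C B : braidedCat K) (F : brComonFunctor C B)
    (M : comonoid C) (X Y : C) : F ((X ⊗ M) ⊗ Y) ~> F (X ⊗ M) ⊗ F (M ⊗ Y) :=
  F2 F (X ⊗ M) (M ⊗ Y) ∘ fmor F (id_comul_id X (comul M) Y).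

Definition adapted K (C B : braidedCat K) (F : brComonFunctor C B)
    (M : comonoid C) : Prop :=
  invertible (chi F M) /\ forall X Y : C, invertible (gamma F M X Y).

Record adaptedCom K (C B : preCartier K) (F : brComonFunctor C B) := AdaptedCom {
  ac_com :> comonoid C;
  ac_cocomm : inf_cocommutative ac_com;
  ac_adapted : adapted F ac_com }.

Section HopfCategory.
Context {K : fieldType} (V : symCat K).

(* id_M ⊗ braid_{M,N} ⊗ id_N *)
Definition id_braid_id (M N : V) : (M ⊗ M) ⊗ (N ⊗ N) ~> (M ⊗ N) ⊗ (M ⊗ N) :=
  idto (tens_MNMN M N) ∘ ((idm M ⊠ braid M N) ⊠ idm N) ∘ idto (tens_MMNN M N).

Definition tens_comul (M N : V) (Delta : M ~> M ⊗ M) (Delta' : N ~> N ⊗ N) :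
    M ⊗ N ~> (M ⊗ N) ⊗ (M ⊗ N) :=
  id_braid_id M N ∘ (Delta ⊠ Delta').

Definition tens_counit (M N : V) (eps : M ~> munit) (eps' : N ~> munit) :
    M ⊗ N ~> munit :=
  lunit munit ∘ (eps ⊠ eps').

Definition is_enriched_category (A0 : Type) (A : A0 -> A0 -> V)
    (m : forall x y z, A x y ⊗ A y z ~> A x z)
    (u : forall x, munit ~> A x x) : Prop :=
  [/\ forall x y z w,
        m x z w ∘ (m x y z ⊠ idm (A z w)) ∘ assoc (A x y) (A y z) (A z w)
          = m x y w ∘ (idm (A x y) ⊠ m y z w),
      forall x y, m x x y ∘ (u x ⊠ idm (A x y)) ∘ lunitV (A x y) = idm (A x y)
    & forall x y, m x y y ∘ (idm (A x y) ⊠ u y) ∘ runitV (A x y)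
        = idm (A x y)].

(* The category axioms together with hopf_comonoid, hopf_mul_morphism and
   hopf_unit_morphism say that A is enriched over the comonoids of V. *)
Record is_hopf_category (A0 : Type) (A : A0 -> A0 -> V)
    (Delta : forall x y, A x y ~> A x y ⊗ A x y)
    (eps : forall x y, A x y ~> munit)
    (m : forall x y z, A x y ⊗ A y z ~> A x z)
    (u : forall x, munit ~> A x x)
    (S : forall x y, A x y ~> A y x) : Prop := IsHopfCategory {
  hopf_category : is_enriched_category m u;
  hopf_comonoid : forall x y, is_comonoid (Delta x y) (eps x y);
  hopf_mul_morphism : forall x y z,
    is_comonoid_morphism
      (tens_comul (Delta x y) (Delta y z)) (tens_counit (eps x y) (eps y z))
      (Delta x z) (eps x z) (m x y z);
  hopf_unit_morphism : forall x,
    is_comonoid_morphism (lunitV munit) (idm munit)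
      (Delta x x) (eps x x) (u x);
  hopf_antipode_r : forall x y,
    m x y x ∘ (idm (A x y) ⊠ S x y) ∘ Delta x y = u x ∘ eps x y;
  hopf_antipode_l : forall x y,
    m y x y ∘ (S x y ⊠ idm (A x y)) ∘ Delta x y = u y ∘ eps x y }.

End HopfCategory.

Section Cauchy.
Context {K : fieldType}.
Implicit Types V W : lmodType K.

(* The n-th coefficient of a Cauchy product: the sum of the G i j over
   i + j = n. *)
Definition cauchy V (G : nat -> nat -> V) (n : nat) : V :=
  \sum_(i < n.+1) G i (n - i)%N.

Lemma eq_cauchy V (G G' : nat -> nat -> V) n :
  (forall i j, G i j = G' i j) -> cauchy G n = cauchy G' n.
Proof. by move=> E; apply: eq_bigr => i _; rewrite E. Qed.

Lemma cauchyS V (G : nat -> nat -> V) n :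
  cauchy G n.+1 = G 0%N n.+1 + cauchy (fun i j => G i.+1 j) n.
Proof. by rewrite /cauchy big_ord_recl subn0. Qed.

Lemma cauchyD V (G G' : nat -> nat -> V) n :
  cauchy (fun i j => G i j + G' i j) n = cauchy G n + cauchy G' n.
Proof. by rewrite /cauchy big_split. Qed.

Lemma cauchyZ V (a : K) (G : nat -> nat -> V) n :
  cauchy (fun i j => a *: G i j) n = a *: cauchy G n.
Proof. by rewrite /cauchy scaler_sumr. Qed.

Lemma cauchyC V (G : nat -> nat -> V) n :
  cauchy G n = cauchy (fun i j => G j i) n.
Proof.
rewrite /cauchy (reindex_inj rev_ord_inj) /=; apply: eq_bigr => i _.
by rewrite subSS subKn // -ltnS.
Qed.

Lemma cauchyA V (G : nat -> nat -> nat -> V) n :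
  cauchy (fun p q => cauchy (fun i j => G i j q) p) n
  = cauchy (fun i r => cauchy (fun j q => G i j q) r) n.
Proof.
elim: n G => [|n IH] G; first by rewrite /cauchy !big_ord1.
rewrite cauchyS [RHS]cauchyS {1}/cauchy big_ord1 subnn.
under eq_cauchy do rewrite cauchyS.
by rewrite cauchyD addrA -cauchyS IH.
Qed.

Lemma cauchyACA V (G : nat -> nat -> nat -> nat -> V) n :
  cauchy (fun p q => cauchy (fun i j => cauchy (fun k l => G i j k l) q) p) n
  = cauchy (fun p q => cauchy (fun i j => cauchy (fun k l => G i k j l) q) p) n.
Proof.
rewrite (cauchyA (fun i j q => cauchy (fun k l => G i j k l) q)).
rewrite (cauchyA (fun i j q => cauchy (fun k l => G i k j l) q)).
apply: eq_cauchy => i r.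
rewrite -(cauchyA (fun j k l => G i j k l)) -(cauchyA (fun j k l => G i k j l)).
by apply: eq_cauchy => p l; rewrite cauchyC.
Qed.

Lemma cauchy0l V (G : nat -> nat -> V) n :
  (forall i j, G i.+1 j = 0) -> cauchy G n = G 0%N n.
Proof.
by move=> G0; rewrite /cauchy big_ord_recl subn0 big1 ?addr0 // => i _; rewrite G0.
Qed.

Lemma cauchy0r V (G : nat -> nat -> V) n :
  (forall i j, G i j.+1 = 0) -> cauchy G n = G n 0%N.
Proof. by move=> G0; rewrite cauchyC cauchy0l. Qed.

Lemma cauchy_lin V W (phi : V -> W) (G : nat -> nat -> V) n :
  (forall (a : K) u v, phi (a *: u + v) = a *: phi u + phi v) ->
  phi (cauchy G n) = cauchy (fun i j => phi (G i j)) n.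
Proof.
move=> lphi.
have phiD u v : phi (u + v) = phi u + phi v by rewrite -{1}[u]scale1r lphi scale1r.
have phi0 : phi 0 = 0.
  by apply: (addrI (phi 0)); rewrite -phiD !addr0.
by rewrite /cauchy (big_morph phi phiD phi0).
Qed.

(* V[[hbar]], a formal power series being its sequence of coefficients;
   cser is the inclusion of V as the constant series. *)
Definition hseries V : lmodType K := (nat -> V)%type.

Definition cser V (v : V) : hseries V := fun n => if n is 0 then v else 0.

End Cauchy.

Section Theory.
Context {K : fieldType}.

Section Cat.
Context {C : linCat K}.
Implicit Types X Y Z W : C.

Lemma mcompDl X Y Z (g g' : Y ~> Z) (f : X ~> Y) :
  (g + g') ∘ f = g ∘ f + g' ∘ f.
Proof. by rewrite -{1}[g]scale1r mcomp_linl scale1r. Qed.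

Lemma mcompDr X Y Z (g : Y ~> Z) (f f' : X ~> Y) :
  g ∘ (f + f') = g ∘ f + g ∘ f'.
Proof. by rewrite -{1}[f]scale1r mcomp_linr scale1r. Qed.

Lemma mcomp0l X Y Z (f : X ~> Y) : (0 : Y ~> Z) ∘ f = 0.
Proof. by apply: (addrI (0 ∘ f)); rewrite -mcompDl !addr0. Qed.

Lemma mcomp0r X Y Z (g : Y ~> Z) : g ∘ (0 : X ~> Y) = 0.
Proof. by apply: (addrI (g ∘ 0)); rewrite -mcompDr !addr0. Qed.

Lemma mcompZl X Y Z a (g : Y ~> Z) (f : X ~> Y) : (a *: g) ∘ f = a *: (g ∘ f).
Proof. by rewrite -[a *: g]addr0 mcomp_linl mcomp0l addr0. Qed.

Lemma mcompZr X Y Z a (g : Y ~> Z) (f : X ~> Y) : g ∘ (a *: f) = a *: (g ∘ f).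
Proof. by rewrite -[a *: f]addr0 mcomp_linr mcomp0r addr0. Qed.

Lemma mcompNl X Y Z (g : Y ~> Z) (f : X ~> Y) : (- g) ∘ f = - (g ∘ f).
Proof. by rewrite -scaleN1r mcompZl scaleN1r. Qed.

Lemma mcompNr X Y Z (g : Y ~> Z) (f : X ~> Y) : g ∘ (- f) = - (g ∘ f).
Proof. by rewrite -scaleN1r mcompZr scaleN1r. Qed.

Lemma mcomp_cauchyl X Y Z (G : nat -> nat -> Y ~> Z) (f : X ~> Y) n :
  cauchy G n ∘ f = cauchy (fun i j => G i j ∘ f) n.
Proof. by apply: (cauchy_lin (phi := fun g => g ∘ f)) => a u v; rewrite mcomp_linl. Qed.

Lemma mcomp_cauchyr X Y Z (G : nat -> nat -> X ~> Y) (g : Y ~> Z) n :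
  g ∘ cauchy G n = cauchy (fun i j => g ∘ G i j) n.
Proof. by apply: (cauchy_lin (phi := fun f => g ∘ f)) => a u v; rewrite mcomp_linr. Qed.

Lemma idto_id X (e : X = X) : idto e = idm X.
Proof. by rewrite (Prop_irrelevance e erefl). Qed.

Lemma idto_irr X Y (e e' : X = Y) : idto e = idto e'.
Proof. by rewrite (Prop_irrelevance e e'). Qed.

Lemma idto_comp X Y Z (e' : Y = Z) (e : X = Y) :
  idto e' ∘ idto e = idto (etrans e e').
Proof. by case: _ / e'; case: _ / e; rewrite mcomp1m. Qed.

Lemma idtoK X Y (e : X = Y) (e' : Y = X) : idto e' ∘ idto e = idm X.
Proof. by rewrite idto_comp idto_id. Qed.

Fixpoint cpow X (t : X ~> X) n : X ~> X :=
  if n is n'.+1 then t ∘ cpow t n' else idm X.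

Lemma cpow_comm X Y (s : Y ~> Y) (t : X ~> X) (f : X ~> Y) n :
  f ∘ t = s ∘ f -> f ∘ cpow t n = cpow s n ∘ f.
Proof.
move=> E; elim: n => [|n IH] /=; first by rewrite mcompm1 mcomp1m.
by rewrite mcompA E -mcompA IH mcompA.
Qed.

(* e^{hbar t}, whose coefficient of hbar^n is t^n / n! *)
Definition exph X (t : X ~> X) : hseries (X ~> X) :=
  fun n => (n`!%:R)^-1 *: cpow t n.

Lemma exph_comm X Y (s : Y ~> Y) (t : X ~> X) (f : X ~> Y) n :
  f ∘ t = s ∘ f -> f ∘ exph t n = exph s n ∘ f.
Proof. by move=> E; rewrite /exph mcompZr mcompZl (cpow_comm _ E). Qed.

Lemma exph0 X n : exph (0 : X ~> X) n = cser (idm X) n.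
Proof.
case: n => [|n]; rewrite /exph /=; first by rewrite invr1 scale1r.
by rewrite mcomp0l scaler0.
Qed.

Lemma natr_neq0 (K0 : [pchar K] =i pred0) n : n.+1%:R != 0 :> K.
Proof. by move/pcharf0P: K0 => ->. Qed.

Lemma exphS (K0 : [pchar K] =i pred0) X (t : X ~> X) n :
  n.+1%:R *: exph t n.+1 = t ∘ exph t n.
Proof.
rewrite /exph scalerA factS natrM invfM [(n.+1%:R * _)]mulrA.
by rewrite divff ?mul1r ?natr_neq0 //= mcompZr.
Qed.

Lemma exphD (K0 : [pchar K] =i pred0) X (s t : X ~> X) n :
  s ∘ t = t ∘ s ->
  cauchy (fun i j => exph s i ∘ exph t j) n = exph (s + t) n.
Proof.
move=> st; elim: n => [|n IH].
  by rewrite /cauchy big_ord1 /exph /= !invr1 !scale1r mcomp1m.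
apply: (scalerI (natr_neq0 K0 n)); rewrite exphS // -IH.
pose G i j := exph s i ∘ exph t j.
have -> : n.+1%:R *: cauchy G n.+1 =
    cauchy (fun i j => i%:R *: G i j + j%:R *: G i j) n.+1.
  rewrite /cauchy scaler_sumr; apply: eq_bigr => i _.
  by rewrite -scalerDl -natrD subnKC // -ltnS.
rewrite cauchyD cauchyS scale0r add0r cauchyC.
rewrite [X in _ + X]cauchyC cauchyS scale0r add0r [X in _ + X]cauchyC cauchyC.
rewrite mcompDl !mcomp_cauchyr; congr (_ + _); apply: eq_cauchy => i j.
  by rewrite /G -mcompZl exphS // mcompA.
rewrite /G -mcompZr exphS // !mcompA; congr (_ ∘ _).
by rewrite (exph_comm (s := s)) // st.
Qed.

End Cat.

Section Mon.
Context {C : monCat K}.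
Implicit Types X Y Z W : C.

Lemma tensmDl X X' Y Y' (f f' : X ~> X') (g : Y ~> Y') :
  (f + f') ⊠ g = f ⊠ g + f' ⊠ g.
Proof. by rewrite -{1}[f]scale1r tensm_linl scale1r. Qed.

Lemma tensmDr X X' Y Y' (f : X ~> X') (g g' : Y ~> Y') :
  f ⊠ (g + g') = f ⊠ g + f ⊠ g'.
Proof. by rewrite -{1}[g]scale1r tensm_linr scale1r. Qed.

Lemma tensm0l X X' Y Y' (g : Y ~> Y') : (0 : X ~> X') ⊠ g = 0.
Proof. by apply: (addrI (0 ⊠ g)); rewrite -tensmDl !addr0. Qed.

Lemma tensm0r X X' Y Y' (f : X ~> X') : f ⊠ (0 : Y ~> Y') = 0.
Proof. by apply: (addrI (f ⊠ 0)); rewrite -tensmDr !addr0. Qed.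

Lemma tensmZl X X' Y Y' a (f : X ~> X') (g : Y ~> Y') :
  (a *: f) ⊠ g = a *: (f ⊠ g).
Proof. by rewrite -[a *: f]addr0 tensm_linl tensm0l addr0. Qed.

Lemma tensmZr X X' Y Y' a (f : X ~> X') (g : Y ~> Y') :
  f ⊠ (a *: g) = a *: (f ⊠ g).
Proof. by rewrite -[a *: g]addr0 tensm_linr tensm0r addr0. Qed.

Lemma tensm_cauchyl X X' Y Y' (G : nat -> nat -> X ~> X') (g : Y ~> Y') n :
  cauchy G n ⊠ g = cauchy (fun i j => G i j ⊠ g) n.
Proof. by apply: (cauchy_lin (phi := fun f => f ⊠ g)) => a u v; rewrite tensm_linl. Qed.

Lemma tensm_cauchyr X X' Y Y' (f : X ~> X') (G : nat -> nat -> Y ~> Y') n :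
  f ⊠ cauchy G n = cauchy (fun i j => f ⊠ G i j) n.
Proof. by apply: (cauchy_lin (phi := fun g => f ⊠ g)) => a u v; rewrite tensm_linr. Qed.

Lemma tens1m_comp X Y Y' Y'' (g' : Y' ~> Y'') (g : Y ~> Y') :
  idm X ⊠ (g' ∘ g) = (idm X ⊠ g') ∘ (idm X ⊠ g).
Proof. by rewrite -tensm_comp mcomp1m. Qed.

Lemma tensm1_comp X Y Y' Y'' (g' : Y' ~> Y'') (g : Y ~> Y') :
  (g' ∘ g) ⊠ idm X = (g' ⊠ idm X) ∘ (g ⊠ idm X).
Proof. by rewrite -tensm_comp mcomp1m. Qed.

Lemma tens1m_exph X Y (t : Y ~> Y) n : idm X ⊠ exph t n = exph (idm X ⊠ t) n.
Proof.
rewrite /exph tensmZr; congr (_ *: _).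
elim: n => [|n /= <-]; first exact: tensm_id.
by rewrite tens1m_comp.
Qed.

Lemma tensm1_exph X Y (t : Y ~> Y) n : exph t n ⊠ idm X = exph (t ⊠ idm X) n.
Proof.
rewrite /exph tensmZl; congr (_ *: _).
elim: n => [|n /= <-]; first exact: tensm_id.
by rewrite tensm1_comp.
Qed.

End Mon.
End Theory.

Section DeformCat.
Context {K : fieldType} (C : linCat K).

Definition hat_hom (X Y : C) : lmodType K := hseries (X ~> Y).

Definition hat_comp (X Y Z : C) (g : hat_hom Y Z) (f : hat_hom X Y) :
  hat_hom X Z := fun n => cauchy (fun i j => g i ∘ f j) n.

Fact hat_compA X Y Z W (h : hat_hom Z W) (g : hat_hom Y Z) (f : hat_hom X Y) :
  hat_comp h (hat_comp g f) = hat_comp (hat_comp h g) f.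
Proof.
apply/funext => n; rewrite /hat_comp.
under eq_cauchy do rewrite mcomp_cauchyr.
under [RHS]eq_cauchy do rewrite mcomp_cauchyl.
rewrite (cauchyA (fun i j k => h i ∘ g j ∘ f k)).
by do 2!apply: eq_cauchy => ? ?; rewrite mcompA.
Qed.

Fact hat_comp1m X Y (f : hat_hom X Y) : hat_comp (cser (idm Y)) f = f.
Proof.
apply/funext => n; rewrite /hat_comp cauchy0l /= ?mcomp1m // => i j.
by rewrite mcomp0l.
Qed.

Fact hat_compm1 X Y (f : hat_hom X Y) : hat_comp f (cser (idm X)) = f.
Proof.
apply/funext => n; rewrite /hat_comp cauchy0r /= ?mcompm1 // => i j.
by rewrite mcomp0r.
Qed.

Fact hat_comp_linl X Y Z (a : K) (g g' : hat_hom Y Z) (f : hat_hom X Y) :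
  hat_comp (a *: g + g') f = a *: hat_comp g f + hat_comp g' f.
Proof.
apply/funext => n; transitivity (a *: hat_comp g f n + hat_comp g' f n); last by [].
rewrite /hat_comp -cauchyZ -cauchyD.
by apply: eq_cauchy => i j; rewrite [(a *: g + g') i]/(a *: g i + g' i) mcomp_linl.
Qed.

Fact hat_comp_linr X Y Z (a : K) (g : hat_hom Y Z) (f f' : hat_hom X Y) :
  hat_comp g (a *: f + f') = a *: hat_comp g f + hat_comp g f'.
Proof.
apply/funext => n; transitivity (a *: hat_comp g f n + hat_comp g f' n); last by [].
rewrite /hat_comp -cauchyZ -cauchyD.
by apply: eq_cauchy => i j; rewrite [(a *: f + f') j]/(a *: f j + f' j) mcomp_linr.
Qed.

Definition hat_cat : linCat K :=
  LinCat hat_compA hat_comp1m hat_compm1 hat_comp_linl hat_comp_linr.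

End DeformCat.

Section DeformMon.
Context {K : fieldType} (C : monCat K).

Lemma hat_idto (X Y : C) (e : X = Y) :
  @idto K (hat_cat C) X Y e = cser (idto e).
Proof. by case: _ / e. Qed.

Lemma hat_mcomp_cserl (X Y Z : C) (g : Y ~> Z) (f : hat_hom X Y) n :
  hat_comp (cser g) f n = g ∘ f n.
Proof. by rewrite /hat_comp cauchy0l // => i j; rewrite mcomp0l. Qed.

Lemma hat_mcomp_cserr (X Y Z : C) (g : hat_hom Y Z) (f : X ~> Y) n :
  hat_comp g (cser f) n = g n ∘ f.
Proof. by rewrite /hat_comp cauchy0r // => i j; rewrite mcomp0r. Qed.

Lemma hat_mcomp_cser (X Y Z : C) (g : Y ~> Z) (f : X ~> Y) :
  hat_comp (cser g) (cser f) = cser (g ∘ f).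
Proof. by apply/funext => -[|n]; rewrite hat_mcomp_cserl //= mcomp0r. Qed.

Definition hat_tensm (X X' Y Y' : C) (f : hat_hom X X') (g : hat_hom Y Y') :
  hat_hom (X ⊗ Y) (X' ⊗ Y') := fun n => cauchy (fun i j => f i ⊠ g j) n.

Lemma hat_tensm_cserl (X X' Y Y' : C) (f : X ~> X') (g : hat_hom Y Y') n :
  hat_tensm (cser f) g n = f ⊠ g n.
Proof. by rewrite /hat_tensm cauchy0l // => i j; rewrite tensm0l. Qed.

Lemma hat_tensm_cserr (X X' Y Y' : C) (f : hat_hom X X') (g : Y ~> Y') n :
  hat_tensm f (cser g) n = f n ⊠ g.
Proof. by rewrite /hat_tensm cauchy0r // => i j; rewrite tensm0r. Qed.

Lemma hat_tensm_cser (X X' Y Y' : C) (f : X ~> X') (g : Y ~> Y') :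
  hat_tensm (cser f) (cser g) = cser (f ⊠ g).
Proof. by apply/funext => -[|n]; rewrite hat_tensm_cserl //= tensm0r. Qed.

Fact hat_tensm_id X Y :
  hat_tensm (@idm K (hat_cat C) X) (@idm K (hat_cat C) Y) =
  @idm K (hat_cat C) (X ⊗ Y).
Proof. by rewrite /= hat_tensm_cser tensm_id. Qed.

Fact hat_tensm_comp (X X' X'' Y Y' Y'' : C)
    (f' : hat_hom X' X'') (f : hat_hom X X')
    (g' : hat_hom Y' Y'') (g : hat_hom Y Y') :
  hat_tensm (hat_comp f' f) (hat_comp g' g) =
  hat_comp (hat_tensm f' g') (hat_tensm f g).
Proof.
apply/funext => n; rewrite /hat_comp /hat_tensm.
under eq_cauchy => p q.
  rewrite tensm_cauchyl; under eq_cauchy => i j do rewrite tensm_cauchyr.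
  over.
rewrite (cauchyACA (fun i j k l => (f' i ∘ f j) ⊠ (g' k ∘ g l))).
apply: eq_cauchy => p q; rewrite mcomp_cauchyl; apply: eq_cauchy => i j.
by rewrite mcomp_cauchyr; apply: eq_cauchy => k l; rewrite tensm_comp.
Qed.

Fact hat_tensm_linl (X X' Y Y' : C) (a : K)
    (f f' : hat_hom X X') (g : hat_hom Y Y') :
  hat_tensm (a *: f + f') g = a *: hat_tensm f g + hat_tensm f' g.
Proof.
apply/funext => n.
transitivity (a *: hat_tensm f g n + hat_tensm f' g n); last by [].
rewrite /hat_tensm -cauchyZ -cauchyD.
by apply: eq_cauchy => i j; rewrite [(a *: f + f') i]/(a *: f i + f' i) tensm_linl.
Qed.

Fact hat_tensm_linr (X X' Y Y' : C) (a : K)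
    (f : hat_hom X X') (g g' : hat_hom Y Y') :
  hat_tensm f (a *: g + g') = a *: hat_tensm f g + hat_tensm f g'.
Proof.
apply/funext => n.
transitivity (a *: hat_tensm f g n + hat_tensm f g' n); last by [].
rewrite /hat_tensm -cauchyZ -cauchyD.
by apply: eq_cauchy => i j; rewrite [(a *: g + g') j]/(a *: g j + g' j) tensm_linr.
Qed.

Fact hat_tensmA (X X' Y Y' Z Z' : C)
    (f : hat_hom X X') (g : hat_hom Y Y') (h : hat_hom Z Z') :
  hat_comp (@idto K (hat_cat C) _ _ (tensA X' Y' Z'))
    (hat_tensm f (hat_tensm g h)) =
  hat_comp (hat_tensm (hat_tensm f g) h)
    (@idto K (hat_cat C) _ _ (tensA X Y Z)).
Proof.
apply/funext => n; rewrite !hat_idto hat_mcomp_cserl hat_mcomp_cserr.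
rewrite /hat_tensm mcomp_cauchyr mcomp_cauchyl.
under eq_cauchy => p q do rewrite tensm_cauchyr mcomp_cauchyr.
under [RHS]eq_cauchy => p q do rewrite tensm_cauchyl mcomp_cauchyl.
rewrite (cauchyA (fun i j k => (f i ⊠ g j) ⊠ h k ∘ idto (tensA X Y Z))).
by do 2!apply: eq_cauchy => ? ?; rewrite tensmA.
Qed.

Fact hat_tens1m (X X' : C) (f : hat_hom X X') :
  hat_comp (@idto K (hat_cat C) _ _ (tens1X X'))
    (hat_tensm (@idm K (hat_cat C) munit) f) =
  hat_comp f (@idto K (hat_cat C) _ _ (tens1X X)).
Proof.
apply/funext => n; rewrite !hat_idto hat_mcomp_cserl hat_mcomp_cserr.
by rewrite hat_tensm_cserl tens1m.
Qed.

Fact hat_tensm1 (X X' : C) (f : hat_hom X X') :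
  hat_comp (@idto K (hat_cat C) _ _ (tensX1 X'))
    (hat_tensm f (@idm K (hat_cat C) munit)) =
  hat_comp f (@idto K (hat_cat C) _ _ (tensX1 X)).
Proof.
apply/funext => n; rewrite !hat_idto hat_mcomp_cserl hat_mcomp_cserr.
by rewrite hat_tensm_cserr tensm1.
Qed.

Definition hat_mon : monCat K :=
  @MonCat K (hat_cat C) (@tens K C) munit hat_tensm hat_tensm_id
    hat_tensm_comp hat_tensm_linl hat_tensm_linr tensA tens1X tensX1
    hat_tensmA hat_tens1m hat_tensm1.

Lemma hat_hexrE (X Y Z : hat_mon) (u : X ⊗ Z ~> Z ⊗ X) (v : X ⊗ Y ~> Y ⊗ X) n :
  (assoc Y Z X ∘ (idm Y ⊠ u) ∘ assocV Y X Z ∘ (v ⊠ idm Z) ∘ assoc X Y Z) n =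
  cauchy (fun i j => @assoc K C Y Z X ∘ (@idm K C Y ⊠ u i)
    ∘ @assocV K C Y X Z ∘ (v j ⊠ @idm K C Z) ∘ @assoc K C X Y Z) n.
Proof.
rewrite /assoc /assocV !hat_idto /=.
rewrite hat_mcomp_cserr {1}/hat_comp mcomp_cauchyl; apply: eq_cauchy => i j.
by rewrite hat_mcomp_cserr hat_mcomp_cserl hat_tensm_cserl hat_tensm_cserr.
Qed.

Fact hat_comonoidP (M : comonoid C) :
  @is_comonoid K hat_mon M (cser (comul M)) (cser (counit M)).
Proof.
have [Mass Ml Mr] := comonoidP M.
rewrite /is_comonoid /assoc /lunit /runit !(hat_idto) /=.
by rewrite !(hat_tensm_cser, hat_mcomp_cser) Mass Ml Mr.
Qed.

Definition hat_comonoid (M : comonoid C) : comonoid hat_mon :=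
  Comonoid (hat_comonoidP M).

End DeformMon.

Lemma symmetric_hexl K (C : monCat K) (s : forall X Y : C, X ⊗ Y ~> Y ⊗ X) :
  (forall X Y, s Y X ∘ s X Y = idm (X ⊗ Y)) ->
  (forall X Y Z, s X (Y ⊗ Z) =
      assoc Y Z X ∘ (idm Y ⊠ s X Z) ∘ assocV Y X Z
        ∘ (s X Y ⊠ idm Z) ∘ assoc X Y Z) ->
  forall X Y Z, s (X ⊗ Y) Z =
      assocV Z X Y ∘ (s X Z ⊠ idm Y) ∘ assoc X Z Y
        ∘ (idm X ⊠ s Y Z) ∘ assocV X Y Z.
Proof.
move=> ssym shexr X Y Z; rewrite -[RHS]mcompm1 -(ssym (X ⊗ Y) Z) [s Z _]shexr.
have canc (P Q R : C) (a : Q ~> P) (b : P ~> Q) (f : R ~> P) :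
  a ∘ b = idm P -> a ∘ (b ∘ f) = f by move=> ab; rewrite mcompA ab mcomp1m.
rewrite -!mcompA.
rewrite (canc _ _ _ (assocV X Y Z) (assoc X Y Z)); last exact: idtoK.
rewrite (canc _ _ _ (idm X ⊠ s Y Z) (idm X ⊠ s Z Y)); last first.
  by rewrite -tens1m_comp ssym tensm_id.
rewrite (canc _ _ _ (assoc X Z Y) (assocV X Z Y)); last exact: idtoK.
rewrite (canc _ _ _ (s X Z ⊠ idm Y) (s Z X ⊠ idm Y)); last first.
  by rewrite -tensm1_comp ssym tensm_id.
by rewrite (canc _ _ _ (assocV Z X Y) (assoc Z X Y)) //; exact: idtoK.
Qed.

Section DeformBraid.
Context {K : fieldType} (K0 : [pchar K] =i pred0) (C : symPreCartier K).
Context (tcomm : infbr_commutes C) (tskew : infbr_skew C).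

Definition hat_braid (X Y : C) : hat_hom (X ⊗ Y) (Y ⊗ X) :=
  hat_comp (cser (braid X Y)) (exph (infbr X Y)).

Lemma hat_braidE X Y n : hat_braid X Y n = braid X Y ∘ exph (infbr X Y) n.
Proof. exact: hat_mcomp_cserl. Qed.

Fact hat_braid_sym X Y :
  hat_comp (hat_braid Y X) (hat_braid X Y) = @idm K (hat_mon C) (X ⊗ Y).
Proof.
apply/funext => n; rewrite /hat_comp.
under eq_cauchy => i j.
  rewrite !hat_braidE mcompA -[_ ∘ braid X Y]mcompA.
  rewrite -(exph_comm (t := - infbr X Y)); last by rewrite mcompNr tskew.
  rewrite mcompA spc_symP mcomp1m; over.
rewrite exphD ?mcompNl ?mcompNr // addNr; exact: exph0.
Qed.

Fact hat_braidK X Y :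
  @is_inverse K (hat_mon C) _ _ (hat_braid X Y) (hat_braid Y X).
Proof. by split; exact: hat_braid_sym. Qed.

Fact hat_braid_nat (X X' Y Y' : C) (f : hat_hom X X') (g : hat_hom Y Y') :
  hat_comp (hat_tensm g f) (hat_braid X Y) =
  hat_comp (hat_braid X' Y') (hat_tensm f g).
Proof.
apply/funext => n; rewrite /hat_comp [RHS]cauchyC; apply: eq_cauchy => i j.
rewrite /hat_tensm cauchyC mcomp_cauchyl mcomp_cauchyr.
apply: eq_cauchy => k l; rewrite !hat_braidE mcompA braid_nat -!mcompA.
congr (_ ∘ _); exact/exph_comm/infbr_nat.
Qed.

Lemma braidVE X Y : braidV X Y = braid Y X :> (_ ~> (X : C) ⊗ Y).
Proof.
rewrite -[braidV X Y]mcompm1 -(spc_symP Y X) mcompA.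
by rewrite (braidK X Y).1 mcomp1m.
Qed.

Fact hat_braid_hexr (X Y Z : hat_mon C) :
  hat_braid X (Y ⊗ Z) =
    assoc Y Z X ∘ (idm Y ⊠ (hat_braid X Z : X ⊗ Z ~> Z ⊗ X)) ∘ assocV Y X Z
      ∘ ((hat_braid X Y : X ⊗ Y ~> Y ⊗ X) ⊠ idm Z) ∘ assoc X Y Z.
Proof.
apply/funext => n; rewrite hat_hexrE hat_braidE; change (obj C) in X, Y, Z.
under [RHS]eq_cauchy => i j.
  rewrite !hat_braidE tens1m_comp tensm1_comp tens1m_exph tensm1_exph.
  over.
rewrite /assoc /assocV.
set s := braid X Y ⊠ idm Z; set s' := braidV X Y ⊠ idm Z.
set a := idto (tensA X Y Z); set b := idto (esym (tensA Y X Z)).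
set b' := idto (tensA Y X Z).
have sK : s' ∘ s = idm _ by rewrite -tensm1_comp (braidK X Y).1 tensm_id.
have sK' : s ∘ s' = idm _ by rewrite -tensm1_comp (braidK X Y).2 tensm_id.
have bK : b ∘ b' = idm _ by exact: idtoK.
pose A := infbr X Y ⊠ idm Z.
pose B := s' ∘ b' ∘ (idm Y ⊠ infbr X Z) ∘ b ∘ s.
have bsB : (b ∘ s) ∘ B = (idm Y ⊠ infbr X Z) ∘ (b ∘ s).
  rewrite /B !mcompA -[b ∘ s ∘ s']mcompA sK' mcompm1 bK mcomp1m.
  by rewrite -!mcompA.
have sA : s ∘ A = - ((infbr Y X ⊠ idm Z) ∘ s).
  rewrite -!tensm1_comp tskew -[- (braid X Y ∘ _)]scaleN1r.
  by rewrite tensmZl scaleN1r opprK.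
have AB : A ∘ B = B ∘ A.
  pose T := b' ∘ (idm Y ⊠ infbr X Z) ∘ b.
  have sB : s ∘ B = T ∘ s by rewrite /B /T !mcompA sK' mcomp1m.
  have := tcomm Y X Z; rewrite /= -/b -/b' => /eqP; rewrite subr_eq0 => /eqP.
  rewrite /assoc /assocV -/b -/b' -/T => cT.
  have sAB : s ∘ (A ∘ B) = s ∘ (B ∘ A).
    rewrite (mcompA s A) sA mcompNl -(mcompA _ s B) sB mcompA cT.
    by rewrite (mcompA s B) sB -(mcompA T s A) sA mcompNr -(mcompA T).
  by rewrite -[A ∘ B]mcomp1m -sK -mcompA sAB mcompA sK mcomp1m.
rewrite (eq_cauchy (G' := fun i j =>
    (idto (tensA Y Z X) ∘ (idm Y ⊠ braid X Z) ∘ b ∘ s) ∘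
      (exph B i ∘ exph A j) ∘ a)); last first.
  move=> i j; congr (_ ∘ a); rewrite !mcompA; congr (_ ∘ _).
  by rewrite -!mcompA; do 2!congr (_ ∘ _); rewrite (mcompA b s) (exph_comm _ bsB).
rewrite -mcomp_cauchyl -mcomp_cauchyr exphD // addrC braid_hexr.
rewrite /assoc /assocV -/a -/b -/s -!mcompA; do 4!congr (_ ∘ _).
apply: exph_comm; rewrite infbr_hexr /assoc /assocV -/a -/b -/b' -/s -/s'.
by rewrite -/A -/B !mcompA idtoK mcomp1m.
Qed.

Definition hat_br : braidedCat K :=
  @BraidedCat K (hat_mon C) hat_braid (fun X Y => hat_braid Y X)
    hat_braidK hat_braid_nat hat_braid_hexr
    (@symmetric_hexl K (hat_mon C) hat_braid hat_braid_sym hat_braid_hexr).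

Definition deform : symCat K := @SymCat K hat_br hat_braid_sym.

End DeformBraid.

Section DeformFunctor.
Context {K : fieldType} (K0 : [pchar K] =i pred0) (C B : symPreCartier K).
Context (tC : infbr_commutes C) (sC : infbr_skew C).
Context (tB : infbr_commutes B) (sB : infbr_skew B).
Context (F : brComonFunctor C B) (tF : inf_braided F).

Let hC := deform K0 tC sC.
Let hB := deform K0 tB sB.

Definition hat_fmor (X Y : C) (f : hat_hom X Y) : hat_hom (F X) (F Y) :=
  fun n => fmor F (f n).

Lemma fmor0 (X Y : C) : fmor F (0 : X ~> Y) = 0.
Proof.
apply: (addrI (fmor F (0 : X ~> Y))).
by rewrite -{1}[fmor F 0]scale1r -fmor_lin scaler0 !addr0.
Qed.

Lemma hat_fmor_cser (X Y : C) (f : X ~> Y) :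
  hat_fmor (cser f) = cser (fmor F f).
Proof. by apply/funext => -[|n] //; exact: fmor0. Qed.

Lemma fmor_exph (X : C) (t : X ~> X) n : fmor F (exph t n) = exph (fmor F t) n.
Proof.
rewrite /exph -[_ *: cpow t n]addr0 fmor_lin fmor0 addr0; congr (_ *: _).
by elim: n => [|n IH] /=; rewrite ?fmor_id // fmor_comp IH.
Qed.

Fact hat_fmor_id X : hat_fmor (@idm K hC X) = @idm K hB (F X).
Proof. by rewrite /= hat_fmor_cser fmor_id. Qed.

Fact hat_fmor_comp (X Y Z : C) (g : hat_hom Y Z) (f : hat_hom X Y) :
  hat_fmor (hat_comp g f) = hat_comp (hat_fmor g) (hat_fmor f).
Proof.
apply/funext => n; rewrite /hat_fmor /hat_comp.
rewrite (cauchy_lin (phi := @fmor _ _ _ F X Z)) => [|a u v].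
  by apply: eq_cauchy => i j; rewrite fmor_comp.
exact: fmor_lin.
Qed.

Fact hat_fmor_lin (X Y : C) (a : K) (f g : hat_hom X Y) :
  hat_fmor (a *: f + g) = a *: hat_fmor f + hat_fmor g.
Proof. by apply/funext => n; exact: fmor_lin. Qed.

Fact hat_F2_nat (X X' Y Y' : C) (f : hat_hom X X') (g : hat_hom Y Y') :
  hat_comp (cser (F2 F X' Y')) (hat_fmor (hat_tensm f g)) =
  hat_comp (hat_tensm (hat_fmor f) (hat_fmor g)) (cser (F2 F X Y)).
Proof.
apply/funext => n; rewrite hat_mcomp_cserl hat_mcomp_cserr /hat_fmor /hat_tensm.
rewrite (cauchy_lin (phi := @fmor _ _ _ F (X ⊗ Y) (X' ⊗ Y'))) => [|a u v].
  by rewrite mcomp_cauchyr mcomp_cauchyl; apply: eq_cauchy => i j; exact: F2_nat.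
exact: fmor_lin.
Qed.

Fact hat_F2_braid (X Y : C) :
  hat_comp (hat_braid (F X) (F Y)) (cser (F2 F X Y)) =
  hat_comp (cser (F2 F Y X)) (hat_fmor (hat_braid X Y)).
Proof.
apply/funext => n; rewrite hat_mcomp_cserl hat_mcomp_cserr /hat_fmor !hat_braidE.
rewrite fmor_comp fmor_exph mcompA -F2_braid -!mcompA; congr (_ ∘ _).
by apply/esym/exph_comm; exact: tF.
Qed.

Let hF (X : hC) : hB := F X.
Let hF0 : hF munit ~> munit := cser (F0 F).
Let hF2 (X Y : hC) : hF (X ⊗ Y) ~> hF X ⊗ hF Y := cser (F2 F X Y).

Fact hat_F2_coassoc (X Y Z : hC) :
  assoc (hF X) (hF Y) (hF Z) ∘ (idm (hF X) ⊠ hF2 Y Z) ∘ hF2 X (Y ⊗ Z)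
  = (hF2 X Y ⊠ idm (hF Z)) ∘ hF2 (X ⊗ Y) Z
      ∘ (hat_fmor (assoc X Y Z) : hF _ ~> hF _).
Proof.
rewrite /assoc (@hat_idto K C) (@hat_idto K B) /= hat_fmor_cser.
by rewrite !(hat_tensm_cser, hat_mcomp_cser) F2_coassoc.
Qed.

Fact hat_F2_counitl (X : hC) :
  lunit (hF X) ∘ (hF0 ⊠ idm (hF X)) ∘ hF2 munit X = hat_fmor (lunit X).
Proof.
rewrite /lunit (@hat_idto K C) (@hat_idto K B) /= hat_fmor_cser.
by rewrite !(hat_tensm_cser, hat_mcomp_cser) F2_counitl.
Qed.

Fact hat_F2_counitr (X : hC) :
  runit (hF X) ∘ (idm (hF X) ⊠ hF0) ∘ hF2 X munit = hat_fmor (runit X).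
Proof.
rewrite /runit (@hat_idto K C) (@hat_idto K B) /= hat_fmor_cser.
by rewrite !(hat_tensm_cser, hat_mcomp_cser) F2_counitr.
Qed.

Definition deform_functor : brComonFunctor hC hB :=
  @BrComonFunctor K hC hB F hat_fmor hat_fmor_id hat_fmor_comp hat_fmor_lin
    (cser (F0 F)) (fun X Y => cser (F2 F X Y))
    hat_F2_nat hat_F2_coassoc hat_F2_braid hat_F2_counitl hat_F2_counitr.

End DeformFunctor.

(* Main.v *)
(* Infinitesimal cocommutativity gives exp(hbar t) o Delta = Delta, so each
   comonoid stays cocommutative for the deformed braiding; all structure maps
   of the deformed functor being constant series, it also stays adapted.  This
   reduces the theorem to a symmetric comonoidal functor F and a family of
   cocommutative F-adapted comonoids.  There each A_{x,y} is the image of the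
   tensor product comonoid x ⊗ y, and gamma, chi and their inverses are comonoid
   morphisms because Delta_y, eps_y, F2 and F0 are.  Associativity is tested
   after the isomorphism (gamma^y ⊗ id) gamma^z = (id ⊗ gamma^z) gamma^y, on
   which both sides become F(id ⊗ eps_y ⊗ eps_z ⊗ id); the unit laws use
   chi^-1 ⊗ id = F2 F(Delta_x ⊗ id), and the antipode laws use the hexagons.

   These diagrams are computed in a monoidal category whose associativity and
   unit laws hold by conversion, and the result is then carried back. *)

Require Import Defs.
From Stdlib Require Import StrictProp.
From mathcomp Require Import all_boot all_algebra.
From mathcomp Require Import boolp classical_sets.

Set Implicit Arguments.
Unset Strict Implicit.
Unset Printing Implicit Defensive.

Local Open Scope ring_scope.
Local Open Scope lcat_scope.

(** * Strictification up to conversion *)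

Section Heq.
Context {K : fieldType} {C : monCat K}.
Implicit Types X Y Z : C.

(** Equality of morphisms whose endpoints agree only propositionally. Quantifying over the
    equalities keeps casts out of statements, and [subst] removes them in the closure lemmas. *)
Definition heq X Y X' Y' (f : X ~> Y) (f' : X' ~> Y') : Prop :=
  exists (e : X = X') (e' : Y = Y'), idto e' ∘ f = f' ∘ idto e.

Lemma heqP X Y (f f' : X ~> Y) : heq f f' <-> f = f'.
Proof.
split=> [[e [e']]|->]; first by rewrite !idto_id mcomp1m mcompm1.
by exists erefl, erefl; rewrite !idto_id mcomp1m mcompm1.
Qed.

Lemma heq_refl X Y (f : X ~> Y) : heq f f.
Proof. exact/heqP. Qed.

Lemma heq_sym X Y X' Y' (f : X ~> Y) (f' : X' ~> Y') : heq f f' -> heq f' f.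
Proof.
case=> e [e' E]; subst.
by move: E; rewrite !idto_id mcomp1m mcompm1 => ->; exact: heq_refl.
Qed.

Lemma heq_trans X Y X' Y' X'' Y''
    (f : X ~> Y) (f' : X' ~> Y') (f'' : X'' ~> Y'') :
  heq f f' -> heq f' f'' -> heq f f''.
Proof.
move=> [e [e' E]] [d [d' D]]; subst.
by move: E D; rewrite /= !mcomp1m !mcompm1 => -> ->; exact: heq_refl.
Qed.

Lemma heq_comp X Y Z X' Y' Z' (g : Y ~> Z) (f : X ~> Y)
    (g' : Y' ~> Z') (f' : X' ~> Y') :
  heq g g' -> heq f f' -> heq (g ∘ f) (g' ∘ f').
Proof.
move=> [d [d' D]] [e [e' E]]; subst.
move: D E; rewrite !idto_id !mcomp1m !mcompm1 => -> ->; exact: heq_refl.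
Qed.

Lemma heq_tensm X Y Z W X' Y' Z' W' (f : X ~> Y) (g : Z ~> W)
    (f' : X' ~> Y') (g' : Z' ~> W') :
  heq f f' -> heq g g' -> heq (f ⊠ g) (f' ⊠ g').
Proof.
move=> [d [d' D]] [e [e' E]]; subst.
move: D E; rewrite !idto_id !mcomp1m !mcompm1 => -> ->; exact: heq_refl.
Qed.

Lemma heq_idm X Y : X = Y -> heq (idm X) (idm Y).
Proof. by move=> ->; exact: heq_refl. Qed.

Lemma heq_idtol X Y Z W Z' (e : Z = Z') (g : X ~> Z) (f : W ~> Y) :
  heq f g -> heq f (idto e ∘ g).
Proof. by case: _ / e; rewrite mcomp1m. Qed.

Lemma heq_idtor X Y Z W Z' (e : Z' = Z) (g : Z ~> X) (f : W ~> Y) :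
  heq f g -> heq f (g ∘ idto e).
Proof. by case: _ / e g => g; rewrite mcompm1. Qed.

Lemma heq_idto X Y Z (e : Y = Z) : X = Y -> heq (idm X) (idto e).
Proof. by move=> XY; subst; exact: heq_refl. Qed.

End Heq.

(** [Squash P] eliminates only into [SProp]. Excluded middle reduces to the case where [P] fails,
    and there the squashed proof yields an element of [sEmpty]. *)
Lemma unsquash (P : Prop) : Squash P -> P.
Proof.
have [//|nP sP] := pselect P.
have absurd (p : P) : sEmpty := match nP p with end.
exact: sEmpty_ind (fun=> P) (Squash_sind _ (fun=> sEmpty) absurd sP).
Qed.

(* Cayley's construction: an object X is represented by the function X ⊗ -, so
   that tensor products become compositions of functions and are associative
   and unital by conversion.  The proof field lives in SProp in order not to
   obstruct this conversion. *)
Set Primitive Projections.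
Record sobj K (C : monCat K) := SObj {
  sfn : C -> C;
  sfn_tens : Squash (forall Z, sfn Z = sfn munit ⊗ Z) }.
Unset Primitive Projections.

Section Strictification.
Context {K : fieldType} {C : monCat K}.
Implicit Types (X Y Z : C) (P Q R : sobj C).

Lemma sfnE P Z : sfn P Z = sfn P munit ⊗ Z.
Proof. exact: (unsquash (sfn_tens P)). Qed.

Fact sunit_tens : Squash (forall Z : C, Z = munit ⊗ Z).
Proof. by constructor=> Z; rewrite tens1X. Qed.

Definition sunit : sobj C := SObj sunit_tens.

Fact stens_tens P Q :
  Squash (forall Z, sfn P (sfn Q Z) = sfn P (sfn Q munit) ⊗ Z).
Proof.
by constructor=> Z; rewrite sfnE (sfnE Q Z) (sfnE P (sfn Q _)) tensA.
Qed.

Definition stens P Q : sobj C := SObj (stens_tens P Q).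

Fact emb_tens X : Squash (forall Z, X ⊗ Z = (X ⊗ munit) ⊗ Z).
Proof. by constructor=> Z; rewrite tensX1. Qed.

Definition emb X : sobj C := SObj (emb_tens X).

Lemma sfn_emb X : sfn (emb X) munit = X.
Proof. exact: tensX1. Qed.

(** The value at [munit] recovers the represented object, so identities and composites are literally
    those of [C]; only tensor products need a cast. *)
Definition shom P Q : Type := sfn P munit ~> sfn Q munit.

(** The equalities are decided classically rather than taken as arguments, so no proof of them
    enters the term. The value 0 is a default for endpoints that differ. *)
Definition recast X Y X' Y' (f : X ~> Y) : X' ~> Y' :=
  match pselect (X = X'), pselect (Y = Y') with
  | left e, left e' => idto e' ∘ f ∘ idto (esym e)
  | _, _ => 0
  end.

Arguments recast {X Y X' Y'}.

Lemma heq_recast X Y X' Y' (f : X ~> Y) :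
  X = X' -> Y = Y' -> heq (recast f : X' ~> Y') f.
Proof.
move=> e e'; rewrite /recast; case: pselect => // d; case: pselect => // d'.
by apply/heq_sym/heq_idtor/heq_idtol/heq_refl.
Qed.

Definition sid P : shom P P := idm (sfn P munit).
Definition scomp P Q R (g : shom Q R) (f : shom P Q) : shom P R := g ∘ f.
Definition stensm P P' Q Q' (f : shom P P') (g : shom Q Q') :
    shom (stens P Q) (stens P' Q') :=
  recast (f ⊠ g).

(** This is [heq] with [P] and [Q] retained as arguments, since the hom space underlying [shom P Q]
    does not determine them. *)
Definition sheq P Q X Y (f : shom P Q) (g : X ~> Y) : Prop := heq f g.

Lemma sheq_refl P Q (f : shom P Q) : sheq f (f : _ ~> _).
Proof. exact: heq_refl. Qed.

(** Carries an equation of the strictification back to [C]; [sheqP] goes the other way. *)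
Lemma sheq_eq P Q (f : shom P Q) X Y (g g' : X ~> Y) :
  sheq f g -> sheq f g' -> g = g'.
Proof. by move=> fg fg'; apply/heqP/(heq_trans (heq_sym fg)). Qed.

Lemma sheq_dom P Q (f : shom P Q) X Y (g : X ~> Y) :
  sheq f g -> sfn P munit = X.
Proof. by case. Qed.

Lemma sheqP P Q (f g : shom P Q) X Y (h : X ~> Y) :
  sheq f h -> sheq g h -> f = g.
Proof. by move=> fh gh; apply/heqP/(heq_trans fh)/heq_sym. Qed.

Lemma sheq_heq P Q (f : shom P Q) X Y (g : X ~> Y) X' Y' (g' : X' ~> Y') :
  sheq f g -> heq g g' -> sheq f g'.
Proof. exact: heq_trans. Qed.

Lemma sheq_sid P X : sfn P munit = X -> sheq (sid P) (idm X).
Proof. exact: heq_idm. Qed.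

Lemma sheq_idtol P Q (f : shom P Q) X Y Z (e : Y = Z) (g : X ~> Y) :
  sheq f g -> sheq f (idto e ∘ g).
Proof. exact: heq_idtol. Qed.

Lemma sheq_idtor P Q (f : shom P Q) X Y Z (e : Z = X) (g : X ~> Y) :
  sheq f g -> sheq f (g ∘ idto e).
Proof. exact: heq_idtor. Qed.

Lemma sheq_scomp P Q R (g : shom Q R) (f : shom P Q)
    X Y Z (g' : Y ~> Z) (f' : X ~> Y) :
  sheq g g' -> sheq f f' -> sheq (scomp g f) (g' ∘ f').
Proof. exact: heq_comp. Qed.

(** By [sfnE], [sfn P (sfn Q munit)] equals [sfn P munit ⊗ sfn Q munit], so the [recast] in [stensm]
    is a genuine cast. *)
Lemma sheq_stensm P P' Q Q' (f : shom P P') (g : shom Q Q')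
    X X' Y Y' (f' : X ~> X') (g' : Y ~> Y') :
  sheq f f' -> sheq g g' -> sheq (stensm f g) (f' ⊠ g').
Proof.
move=> ff' gg'; apply: heq_trans (heq_tensm ff' gg').
by apply: heq_recast; rewrite /= [RHS]sfnE.
Qed.

End Strictification.

Arguments recast {K C X Y X' Y'}.

(* The operands are passed explicitly, since unification would otherwise guess
   the splitting of a tensor product from a wrongly bracketed type. *)
Ltac sheq_step :=
  first [ exact: sheq_refl
        | match goal with
          | |- sheq (stensm ?f ?g) _ => apply: (@sheq_stensm _ _ _ _ _ _ f g)
          | |- sheq (scomp ?g ?f) _ => apply: (@sheq_scomp _ _ _ _ _ g f)
          end
        | solve [ apply: sheq_sid => //; rewrite /= -?sfnE // ] ].
Ltac sheq_auto := by repeat sheq_step.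

Notation "P • Q" := (stens P Q) (at level 38, left associativity) : lcat_scope.
Notation "f ∥ g" := (stensm f g) (at level 38, left associativity) : lcat_scope.
Notation "g ⊚ f" := (scomp g f) (at level 39, left associativity) : lcat_scope.

(** * Strict monoidal laws without casts *)

Section StrictLaws.
Context {K : fieldType} {C : monCat K}.
Implicit Types P Q R : sobj C.

Lemma scompA P Q R T (h : shom R T) (g : shom Q R) (f : shom P Q) :
  h ⊚ (g ⊚ f) = h ⊚ g ⊚ f.
Proof. exact: mcompA. Qed.

Lemma scomp1m P Q (f : shom P Q) : sid Q ⊚ f = f.
Proof. exact: mcomp1m. Qed.

Lemma scompm1 P Q (f : shom P Q) : f ⊚ sid P = f.
Proof. exact: mcompm1. Qed.

Lemma stensm_id P Q : sid P ∥ sid Q = sid (P • Q).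
Proof.
apply: sheqP (sheq_stensm (sheq_refl _) (sheq_refl _)) _.
by rewrite tensm_id; apply: sheq_sid; rewrite /= [LHS]sfnE.
Qed.

Lemma stensm_comp P P' P'' Q Q' Q'' (f' : shom P' P'') (f : shom P P')
    (g' : shom Q' Q'') (g : shom Q Q') :
  (f' ⊚ f) ∥ (g' ⊚ g) = (f' ∥ g') ⊚ (f ∥ g).
Proof.
apply: sheqP (sheq_stensm (sheq_refl _) (sheq_refl _)) _.
rewrite tensm_comp.
by apply: sheq_scomp; apply: sheq_stensm; exact: sheq_refl.
Qed.

Lemma stensmA P P' Q Q' R R' (f : shom P P') (g : shom Q Q') (h : shom R R') :
  f ∥ (g ∥ h) = f ∥ g ∥ h.
Proof.
have fgh : sheq (f ∥ (g ∥ h)) ((f : _ ~> _) ⊠ ((g : _ ~> _) ⊠ (h : _ ~> _))).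
  sheq_auto.
apply: sheqP (sheq_heq fgh _) _; first by do 2!eexists; exact: tensmA.
sheq_auto.
Qed.

Lemma stens1m P Q (f : shom P Q) : sid sunit ∥ f = f.
Proof.
have e : sheq (sid sunit ∥ f) (idm munit ⊠ (f : _ ~> _)) by sheq_auto.
by apply: sheqP (sheq_heq e _) (sheq_refl f); do 2!eexists; exact: tens1m.
Qed.

Lemma stensm1 P Q (f : shom P Q) : f ∥ sid sunit = f.
Proof.
have e : sheq (f ∥ sid sunit) ((f : _ ~> _) ⊠ idm munit) by sheq_auto.
by apply: sheqP (sheq_heq e _) (sheq_refl f); do 2!eexists; exact: tensm1.
Qed.

End StrictLaws.

(** * The braiding of the strictification *)

Section StrictBraid.
Context {K : fieldType} {C : braidedCat K}.
Implicit Types P Q R : sobj C.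

Lemma sfn_stens P Q X Y : sfn P munit = X -> sfn Q munit = Y ->
  sfn (P • Q) munit = X ⊗ Y.
Proof. by move=> <- <- /=; rewrite [LHS]sfnE. Qed.

Definition sbraid P Q : shom (P • Q) (Q • P) :=
  recast (braid (sfn P munit) (sfn Q munit)).

Lemma sheq_sbraid P Q X Y : sfn P munit = X -> sfn Q munit = Y ->
  sheq (sbraid P Q) (braid X Y).
Proof.
move=> <- <-.
by apply: heq_recast; rewrite [RHS](@sfn_stens _ _ _ _ erefl erefl).
Qed.

Lemma sbraid_nat P P' Q Q' (f : shom P P') (g : shom Q Q') :
  (g ∥ f) ⊚ sbraid P Q = sbraid P' Q' ⊚ (f ∥ g).
Proof.
have s1 := @sheq_sbraid P Q _ _ erefl erefl.
have s2 := @sheq_sbraid P' Q' _ _ erefl erefl.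
have t1 := sheq_stensm (sheq_refl g) (sheq_refl f).
have t2 := sheq_stensm (sheq_refl f) (sheq_refl g).
apply: sheqP (sheq_scomp t1 s1) _; rewrite braid_nat; exact: sheq_scomp.
Qed.

Lemma sbraid_hexr P Q R :
  sbraid P (Q • R) = (sid Q ∥ sbraid P R) ⊚ (sbraid P Q ∥ sid R).
Proof.
have s1 := @sheq_sbraid P R _ _ erefl erefl.
have s2 := @sheq_sbraid P Q _ _ erefl erefl.
apply: sheqP (sheq_sbraid erefl (sfn_stens erefl erefl)) _.
rewrite braid_hexr; apply/heq_idtor; rewrite /assocV.
apply: sheq_scomp (sheq_stensm s2 (sheq_refl _)).
by apply/heq_idtor; apply/heq_idtol; apply: sheq_stensm (sheq_refl _) s1.
Qed.

Lemma sbraid_hexl P Q R :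
  sbraid (P • Q) R = (sbraid P R ∥ sid Q) ⊚ (sid P ∥ sbraid Q R).
Proof.
have s1 := @sheq_sbraid P R _ _ erefl erefl.
have s2 := @sheq_sbraid Q R _ _ erefl erefl.
apply: sheqP (sheq_sbraid (sfn_stens erefl erefl) erefl) _.
rewrite braid_hexl; apply/heq_idtor; rewrite /assoc.
apply: sheq_scomp (sheq_stensm (sheq_refl _) s2).
by apply/heq_idtor; apply/heq_idtol; apply: sheq_stensm s1 (sheq_refl _).
Qed.

(** A left inverse is enough to turn an idempotent into an identity, which is how the braidings with
    the unit are computed. *)
Lemma sbraid_retraction P Q : exists sV, sV ⊚ sbraid P Q = sid (P • Q).
Proof.
pose s := braidV (sfn P munit) (sfn Q munit).
have PQ := @sfn_stens P Q _ _ erefl erefl.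
have QP := @sfn_stens Q P _ _ erefl erefl.
exists (recast s); apply: sheqP (sheq_sid PQ); rewrite -(braidK _ _).1.
by apply: sheq_scomp (sheq_sbraid erefl erefl); exact: heq_recast.
Qed.

(* The hexagons make these braidings idempotent, and they are invertible. *)
Lemma sbraid_sunitr P : sbraid P sunit = sid P.
Proof.
have [sV sVs] := sbraid_retraction P sunit.
have := @sbraid_hexr P sunit sunit; rewrite stens1m stensm1 => ss.
by rewrite -[sbraid P sunit]scomp1m -sVs -scompA -ss sVs.
Qed.

Lemma sbraid_sunitl P : sbraid sunit P = sid P.
Proof.
have [sV sVs] := sbraid_retraction sunit P.
have := @sbraid_hexl sunit sunit P; rewrite stens1m stensm1 => ss.
by rewrite -[sbraid sunit P]scomp1m -sVs -scompA -ss sVs.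
Qed.

End StrictBraid.

(** * Comonoidal functors between strictifications *)

Section StrictFunctor.
Context {K : fieldType} {C B : braidedCat K} (F : brComonFunctor C B).
Implicit Types P Q R : sobj C.

Definition sfobj P : sobj B := emb (F (sfn P munit)).

Lemma sfn_sfobj P X : sfn P munit = X -> sfn (sfobj P) munit = F X.
Proof. by move=> <-; exact: sfn_emb. Qed.

Definition sfmor P Q (f : shom P Q) : shom (sfobj P) (sfobj Q) :=
  recast (fmor F f).

Definition sF0 : shom (sfobj sunit) sunit := recast (F0 F).

Definition sF2 P Q : shom (sfobj (P • Q)) (sfobj P • sfobj Q) :=
  recast (F2 F (sfn P munit) (sfn Q munit)).

Lemma sheq_sfmor P Q (f : shom P Q) X Y (g : X ~> Y) :
  sheq f g -> sheq (sfmor f) (fmor F g).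
Proof.
move=> fg; apply: (@sheq_heq _ _ _ _ _ _ _ (fmor F f)).
  by apply: heq_recast; rewrite sfn_emb.
case: fg => e [e' E]; subst.
by move: E; rewrite !idto_id mcomp1m mcompm1 => ->; exact: heq_refl.
Qed.

Lemma sheq_sF0 : sheq sF0 (F0 F).
Proof. by apply: heq_recast => //; rewrite sfn_emb. Qed.

Lemma sheq_sF2 P Q X Y : sfn P munit = X -> sfn Q munit = Y ->
  sheq (sF2 P Q) (F2 F X Y).
Proof.
move=> <- <-; apply: heq_recast.
  by rewrite sfn_emb (sfn_stens erefl erefl).
by rewrite (sfn_stens (sfn_emb _) (sfn_emb _)).
Qed.

Lemma sfmor_id P : sfmor (sid P) = sid (sfobj P).
Proof.
apply: sheqP (sheq_sfmor (sheq_refl _)) _; rewrite fmor_id.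
exact/sheq_sid/sfn_emb.
Qed.

Lemma sfmor_comp P Q R (g : shom Q R) (f : shom P Q) :
  sfmor (g ⊚ f) = sfmor g ⊚ sfmor f.
Proof.
apply: sheqP (sheq_sfmor (sheq_refl _)) _; rewrite fmor_comp.
by apply: sheq_scomp; exact/sheq_sfmor/sheq_refl.
Qed.

Lemma sF2_nat P P' Q Q' (f : shom P P') (g : shom Q Q') :
  sF2 P' Q' ⊚ sfmor (f ∥ g) = (sfmor f ∥ sfmor g) ⊚ sF2 P Q.
Proof.
have t := sheq_stensm (sheq_refl f) (sheq_refl g).
apply: sheqP (sheq_scomp (sheq_sF2 erefl erefl) (sheq_sfmor t)) _.
rewrite F2_nat; apply: sheq_scomp; last exact: sheq_sF2.
by apply: sheq_stensm; exact/sheq_sfmor/sheq_refl.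
Qed.

Lemma fmor_idto (X Y : C) (e : X = Y) :
  fmor F (idto e) = idto (congr1 (fobj F) e).
Proof. by case: _ / e; rewrite fmor_id. Qed.

Lemma sF2_coassoc P Q R :
  (sid (sfobj P) ∥ sF2 Q R) ⊚ sF2 P (Q • R)
  = (sF2 P Q ∥ sid (sfobj R)) ⊚ sF2 (P • Q) R.
Proof.
have i S : sheq (sid (sfobj S)) (idm (F (sfn S munit))).
  exact/sheq_sid/sfn_emb.
have l := sheq_scomp (sheq_stensm (i P) (@sheq_sF2 Q R _ _ erefl erefl))
  (@sheq_sF2 P (Q • R) _ _ erefl (sfn_stens erefl erefl)).
have r := sheq_scomp (sheq_stensm (@sheq_sF2 P Q _ _ erefl erefl) (i R))
  (@sheq_sF2 (P • Q) R _ _ (sfn_stens erefl erefl) erefl).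
apply: sheqP l (sheq_heq r _).
have := F2_coassoc F (sfn P munit) (sfn Q munit) (sfn R munit).
rewrite fmor_idto -mcompA => co.
(* The image of the associator under [F] is an identity cast; it is inserted on the right so that
   [co] applies. *)
apply: heq_trans (heq_idtor (congr1 (fobj F) (tensA _ _ _)) (heq_refl _)) _.
by rewrite -co; apply/heq_sym/heq_idtol/heq_refl.
Qed.

Lemma sF2_braid P Q :
  sbraid (sfobj P) (sfobj Q) ⊚ sF2 P Q = sF2 Q P ⊚ sfmor (sbraid P Q).
Proof.
have s := @sheq_sbraid _ _ (sfobj P) (sfobj Q) _ _ (sfn_emb _) (sfn_emb _).
have l := sheq_scomp s (@sheq_sF2 P Q _ _ erefl erefl).
apply: sheqP l _; rewrite F2_braid; apply: sheq_scomp; first exact: sheq_sF2.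
exact/sheq_sfmor/sheq_sbraid.
Qed.

Lemma sF2_counitl P : (sF0 ∥ sid (sfobj P)) ⊚ sF2 sunit P = sid (sfobj P).
Proof.
have i : sheq (sid (sfobj P)) (idm (F (sfn P munit))) by exact/sheq_sid/sfn_emb.
have l := sheq_scomp (sheq_stensm sheq_sF0 i)
  (@sheq_sF2 sunit P _ _ erefl erefl).
apply: sheqP (sheq_heq l _) i.
apply: heq_trans (heq_idtol (tens1X _) (heq_refl _)) _.
rewrite mcompA F2_counitl fmor_idto; apply/heq_sym/heq_idto.
by rewrite tens1X.
Qed.

Lemma sF2_counitr P : (sid (sfobj P) ∥ sF0) ⊚ sF2 P sunit = sid (sfobj P).
Proof.
have i : sheq (sid (sfobj P)) (idm (F (sfn P munit))) by exact/sheq_sid/sfn_emb.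
have l := sheq_scomp (sheq_stensm i sheq_sF0)
  (@sheq_sF2 P sunit _ _ erefl erefl).
apply: sheqP (sheq_heq l _) i.
apply: heq_trans (heq_idtol (tensX1 _) (heq_refl _)) _.
rewrite mcompA F2_counitr fmor_idto; apply/heq_sym/heq_idto.
by rewrite tensX1.
Qed.

End StrictFunctor.

(* The operands are passed explicitly for the same reason as in sheq_step. *)
Ltac smerge := repeat match goal with
  |- context [scomp (stensm ?a ?b) (stensm ?c ?d)] =>
    rewrite -(stensm_comp a c b d) end.

Ltac sassoc := repeat match goal with
  |- context [stensm ?a (stensm ?b ?c)] => rewrite (stensmA a b c) end.

(** * Comonoids *)

Section StrictComonoids.
Context {K : fieldType} {C : monCat K}.
Implicit Types M N P Q R : sobj C.

Lemma sidl_comp P Q R T (g : shom Q R) (f : shom P Q) :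
  sid T ∥ (g ⊚ f) = (sid T ∥ g) ⊚ (sid T ∥ f).
Proof. by rewrite -stensm_comp scomp1m. Qed.

Lemma sidr_comp P Q R T (g : shom Q R) (f : shom P Q) :
  (g ⊚ f) ∥ sid T = (g ∥ sid T) ⊚ (f ∥ sid T).
Proof. by rewrite -stensm_comp scomp1m. Qed.

Definition sinverse P Q (f : shom P Q) (g : shom Q P) : Prop :=
  g ⊚ f = sid P /\ f ⊚ g = sid Q.

Definition is_scomonoid M (D : shom M (M • M)) (e : shom M sunit) : Prop :=
  [/\ (sid M ∥ D) ⊚ D = (D ∥ sid M) ⊚ D, (e ∥ sid M) ⊚ D = sid M
    & (sid M ∥ e) ⊚ D = sid M].

Definition is_scmor M (D : shom M (M • M)) (e : shom M sunit)
    N (D' : shom N (N • N)) (e' : shom N sunit) (f : shom M N) : Prop :=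
  (f ∥ f) ⊚ D = D' ⊚ f /\ e' ⊚ f = e.

Lemma scmor_id M (D : shom M (M • M)) e : is_scmor D e D e (sid M).
Proof. by split; rewrite ?stensm_id ?scomp1m ?scompm1. Qed.

Lemma scmor_comp M D e N D' e' P D'' e'' (g : shom N P) (f : shom M N) :
  is_scmor D' e' D'' e'' g -> is_scmor D e D' e' f ->
  is_scmor D e D'' e'' (g ⊚ f).
Proof.
move=> [gD ge] [fD fe]; split; last by rewrite scompA ge.
by rewrite stensm_comp -scompA fD !scompA gD.
Qed.

(** Needed for the inverses of gamma and chi, which enter the multiplication and the unit. *)
Lemma scmor_inv M D e N D' e' (f : shom M N) (g : shom N M) :
  g ⊚ f = sid M -> f ⊚ g = sid N ->
  is_scmor D e D' e' f -> is_scmor D' e' D e g.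
Proof.
move=> gf fg [fD fe]; split; last by rewrite -fe -scompA fg scompm1.
rewrite -[D' in LHS]scompm1 -fg (scompA D') -fD !scompA.
rewrite -(stensm_comp g f g f) gf.
by rewrite stensm_id scomp1m.
Qed.

End StrictComonoids.

(** * Tensor products of comonoids *)

Section TensorComonoids.
Context {K : fieldType} {C : braidedCat K}.
Implicit Types M N P Q R : sobj C.

Definition stcomul M N (D : shom M (M • M)) (D' : shom N (N • N)) :
    shom (M • N) ((M • N) • (M • N)) :=
  (sid M ∥ sbraid M N ∥ sid N) ⊚ (D ∥ D').

Definition stcounit M N (e : shom M sunit) (e' : shom N sunit) :
  shom (M • N) sunit := e ∥ e'.

Lemma stcomul_mor M D e N D' e' M1 D1 e1 N1 D1' e1'
    (f : shom M M1) (g : shom N N1) :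
  is_scmor D e D1 e1 f -> is_scmor D' e' D1' e1' g ->
  is_scmor (stcomul D D') (stcounit e e')
    (stcomul D1 D1') (stcounit e1 e1') (f ∥ g).
Proof.
move=> [fD fe] [gD ge]; split; last by rewrite /stcounit; smerge; rewrite fe ge.
rewrite /stcomul -[RHS]scompA -(stensm_comp D1 f D1' g) -fD -gD stensm_comp.
rewrite !scompA.
congr (_ ⊚ _).
have -> : (f ∥ g) ∥ (f ∥ g) = f ∥ (g ∥ f) ∥ g by sassoc.
have -> : (f ∥ f) ∥ (g ∥ g) = f ∥ (f ∥ g) ∥ g by sassoc.
by smerge; rewrite sbraid_nat !scomp1m !scompm1.
Qed.

(** By the hexagons both sides start with the crossing of the two middle factors; the two crossings
    that remain act on disjoint factors and commute. *)
Lemma braid_braidr M N :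
  (sid N ∥ sid M ∥ sbraid M N) ⊚ (sbraid (M • M) N ∥ sid N)
  = (sbraid M N ∥ sid N ∥ sid M) ⊚ (sid M ∥ sbraid M (N • N)).
Proof.
rewrite sbraid_hexl sbraid_hexr sidl_comp sidr_comp !scompA.
congr (_ ⊚ _); last by sassoc.
have -> : sid N ∥ sid M ∥ sbraid M N = sid (N • M) ∥ sbraid M N.
  by rewrite stensm_id.
have -> : sbraid M N ∥ sid N ∥ sid M = sbraid M N ∥ sid (N • M).
  by rewrite -stensm_id; sassoc.
have -> : sbraid M N ∥ sid M ∥ sid N = sbraid M N ∥ sid (M • N).
  by rewrite -stensm_id; sassoc.
have -> : sid M ∥ (sid N ∥ sbraid M N) = sid (M • N) ∥ sbraid M N.
  by rewrite -stensm_id; sassoc.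
by smerge; rewrite !scomp1m !scompm1.
Qed.

(** Naturality moves every crossing after every comultiplication. Coassociativity of the factors
    then matches the comultiplications, and [braid_braidr] the crossings. *)
Lemma stcomulA M D e N D' e' :
  @is_scomonoid _ _ M D e -> @is_scomonoid _ _ N D' e' ->
  (sid (M • N) ∥ stcomul D D') ⊚ stcomul D D'
  = (stcomul D D' ∥ sid (M • N)) ⊚ stcomul D D'.
Proof.
move=> [DA _ _] [DA' _ _]; rewrite /stcomul sidl_comp sidr_comp -!scompA.
have -> : (sid (M • N) ∥ (D ∥ D')) ⊚ ((sid M ∥ sbraid M N ∥ sid N) ⊚ (D ∥ D'))
   = (sid M ∥ sbraid (M • M) N ∥ sid (N • N))
       ⊚ (((sid M ∥ D) ⊚ D) ∥ ((sid N ∥ D') ⊚ D')).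
  rewrite [in RHS]stensm_comp !scompA; congr (_ ⊚ _).
  have -> : sid (M • N) ∥ (D ∥ D') = sid M ∥ (sid N ∥ D) ∥ D'.
    by rewrite -stensm_id; sassoc.
  have -> : (sid M ∥ D) ∥ (sid N ∥ D') = sid M ∥ (D ∥ sid N) ∥ D' by sassoc.
  by smerge; rewrite sbraid_nat !scomp1m !scompm1.
have -> : ((D ∥ D') ∥ sid (M • N)) ⊚ ((sid M ∥ sbraid M N ∥ sid N) ⊚ (D ∥ D'))
   = (sid (M • M) ∥ sbraid M (N • N) ∥ sid N)
       ⊚ (((D ∥ sid M) ⊚ D) ∥ ((D' ∥ sid N) ⊚ D')).
  rewrite [in RHS]stensm_comp !scompA; congr (_ ⊚ _).
  have -> : (D ∥ D') ∥ sid (M • N) = D ∥ (D' ∥ sid M) ∥ sid N.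
    by rewrite -stensm_id; sassoc.
  have -> : (D ∥ sid M) ∥ (D' ∥ sid N) = D ∥ (sid M ∥ D') ∥ sid N by sassoc.
  by smerge; rewrite sbraid_nat !scomp1m !scompm1.
rewrite DA DA' !scompA; congr (_ ⊚ _).
have -> : sid (M • N) ∥ (sid M ∥ sbraid M N ∥ sid N)
    = sid M ∥ (sid N ∥ sid M ∥ sbraid M N) ∥ sid N.
  by rewrite -stensm_id; sassoc.
have -> : sid M ∥ sbraid (M • M) N ∥ sid (N • N)
    = sid M ∥ (sbraid (M • M) N ∥ sid N) ∥ sid N.
  by rewrite -stensm_id; sassoc.
have -> : (sid M ∥ sbraid M N ∥ sid N) ∥ sid (M • N)
    = sid M ∥ (sbraid M N ∥ sid N ∥ sid M) ∥ sid N.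
  by rewrite -stensm_id; sassoc.
have -> : sid (M • M) ∥ sbraid M (N • N) ∥ sid N
    = sid M ∥ (sid M ∥ sbraid M (N • N)) ∥ sid N.
  by rewrite -stensm_id; sassoc.
by smerge; rewrite braid_braidr.
Qed.

(** A counit slid through the crossing turns it into a braiding with the unit, which is an identity;
    the counit laws of the factors remain. *)
Lemma stcomul_counit M D e N D' e' :
  @is_scomonoid _ _ M D e -> @is_scomonoid _ _ N D' e' ->
  is_scomonoid (stcomul D D') (stcounit e e').
Proof.
move=> MP NP; split; first exact: (stcomulA MP NP).
  have [[_ De _] [_ D'e _]] := (MP, NP); rewrite /stcomul /stcounit scompA.
  have -> : e ∥ e' ∥ sid (M • N) = e ∥ (e' ∥ sid M) ∥ sid N.
    by rewrite -stensm_id; sassoc.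
  smerge; rewrite sbraid_nat sbraid_sunitr !scompm1 !scomp1m.
  have -> : e ∥ (sid M ∥ e') ∥ sid N = (e ∥ sid M) ∥ (e' ∥ sid N) by sassoc.
  by smerge; rewrite De D'e stensm_id.
have [[_ _ De] [_ _ D'e]] := (MP, NP); rewrite /stcomul /stcounit scompA.
have -> : sid (M • N) ∥ (e ∥ e') = sid M ∥ (sid N ∥ e) ∥ e'.
  by rewrite -stensm_id; sassoc.
smerge; rewrite sbraid_nat sbraid_sunitl !scompm1 !scomp1m.
have -> : sid M ∥ (e ∥ sid N) ∥ e' = (sid M ∥ e) ∥ (sid N ∥ e') by sassoc.
by smerge; rewrite De D'e stensm_id.
Qed.

(** After the hexagons both sides end with the crossing of [M] and [P]. The earlier crossings, of
    [M] with [N] and of [N] with [P], act on disjoint factors. *)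
Lemma stcomul_assoc M N P (D : shom M (M • M)) (D' : shom N (N • N))
    (D'' : shom P (P • P)) :
  stcomul D (stcomul D' D'') = stcomul (stcomul D D') D''.
Proof.
have -> : stcomul D (stcomul D' D'') =
    (sid M ∥ sbraid M (N • P) ∥ sid (N • P))
      ⊚ (sid (M • M) ∥ (sid N ∥ sbraid N P ∥ sid P)) ⊚ (D ∥ D' ∥ D'').
  have -> : D ∥ D' ∥ D'' = D ∥ (D' ∥ D'') by sassoc.
  by rewrite -scompA; smerge; rewrite scomp1m.
have -> : stcomul (stcomul D D') D'' =
    (sid (M • N) ∥ sbraid (M • N) P ∥ sid P)
      ⊚ ((sid M ∥ sbraid M N ∥ sid N) ∥ sid (P • P)) ⊚ (D ∥ D' ∥ D'').
  by rewrite -scompA; smerge; rewrite scomp1m.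
congr (_ ⊚ _); rewrite sbraid_hexl sbraid_hexr.
have -> : sid M ∥ ((sid N ∥ sbraid M P) ⊚ (sbraid M N ∥ sid P)) ∥ sid (N • P) =
    (sid M ∥ sid N ∥ sbraid M P ∥ sid N ∥ sid P)
      ⊚ (sid M ∥ sbraid M N ∥ (sid P ∥ sid N ∥ sid P)).
  rewrite sidl_comp sidr_comp -stensm_id; congr (_ ⊚ _); by sassoc.
have -> : sid (M • N) ∥ ((sbraid M P ∥ sid N) ⊚ (sid M ∥ sbraid N P)) ∥ sid P =
    (sid M ∥ sid N ∥ sbraid M P ∥ sid N ∥ sid P)
      ⊚ (sid M ∥ sid N ∥ sid M ∥ (sbraid N P ∥ sid P)).
  by rewrite sidl_comp sidr_comp -stensm_id; congr (_ ⊚ _); sassoc.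
rewrite -!scompA; congr (_ ⊚ _).
have -> : sid (M • M) ∥ (sid N ∥ sbraid N P ∥ sid P) =
    sid M ∥ sid (M • N) ∥ (sbraid N P ∥ sid P).
  by rewrite -!stensm_id; sassoc.
have -> : sid M ∥ sbraid M N ∥ sid N ∥ sid (P • P) =
    sid M ∥ sbraid M N ∥ sid (N • P • P).
  by rewrite -!stensm_id; sassoc.
have -> : sid M ∥ sid N ∥ sid M = sid M ∥ sid (N • M).
  by rewrite -!stensm_id; sassoc.
by rewrite !stensm_id; smerge; rewrite !scomp1m !scompm1.
Qed.

Lemma stcomul_unitr M (D : shom M (M • M)) :
  stcomul D (sid sunit : shom sunit (sunit • sunit)) = D.
Proof. by rewrite /stcomul sbraid_sunitr !stensm1 stensm_id scomp1m. Qed.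

(** Coassociativity rewrites [(D ∥ D) ⊚ D] so that one [D] produces the two middle factors, where
    cocommutativity absorbs the crossing. *)
Lemma scomul_mor M D e : @is_scomonoid _ _ M D e -> sbraid M M ⊚ D = D ->
  is_scmor D e (stcomul D D) (stcounit e e) D.
Proof.
move=> [DA De eD] DC; split; last first.
  rewrite /stcounit; have -> : e ∥ e = (e ∥ sid sunit) ⊚ (sid M ∥ e).
    by smerge; rewrite scomp1m scompm1.
  by rewrite -scompA eD scompm1 stensm1.
rewrite /stcomul -scompA.
have -> : (D ∥ D) ⊚ D = (sid M ∥ D ∥ sid M) ⊚ (D ∥ sid M) ⊚ D.
  have -> : D ∥ D = (D ∥ sid (M • M)) ⊚ (sid M ∥ D).
    by smerge; rewrite scomp1m scompm1.
  rewrite -scompA DA -stensm_id !scompA.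
  have -> : D ∥ (sid M ∥ sid M) = (D ∥ sid M) ∥ sid M by sassoc.
  by smerge; rewrite -DA; smerge; rewrite DA.
by rewrite !scompA; smerge; rewrite DC !scomp1m.
Qed.

Lemma scounit_mor M D e : @is_scomonoid _ _ M D e ->
  is_scmor D e (sid sunit : shom sunit (sunit • sunit)) (sid sunit) e.
Proof.
move=> [DA De eD]; split; last by rewrite scomp1m.
have -> : e ∥ e = (e ∥ sid sunit) ⊚ (sid M ∥ e).
  by smerge; rewrite scomp1m scompm1.
by rewrite -scompA eD scompm1 stensm1 scomp1m.
Qed.

End TensorComonoids.

(** * The Hopf category of a family of adapted comonoids *)

Section StrictHopf.
Context {K : fieldType} {C B : braidedCat K} (F : brComonFunctor C B).
Implicit Types M N P Q R X Y Z W : sobj C.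

Local Notation Fo := (sfobj F).
Local Notation Fm := (sfmor F).
Local Notation F2 := (sF2 F).
Local Notation F0 := (sF0 F).

(** * Images of comonoids under a comonoidal functor *)

Definition sfcomul M (D : shom M (M • M)) : shom (Fo M) (Fo M • Fo M) :=
  F2 M M ⊚ Fm D.

Definition sfcounit M (e : shom M sunit) : shom (Fo M) sunit := F0 ⊚ Fm e.

Lemma sfcomul_counit M D e : @is_scomonoid _ _ M D e ->
  is_scomonoid (sfcomul D) (sfcounit e).
Proof.
move=> [DA De eD]; rewrite /sfcomul /sfcounit; split.
- rewrite sidl_comp sidr_comp !scompA -(scompA _ (sid _ ∥ Fm D)).
  rewrite -(scompA _ (Fm D ∥ sid _)) -(sfmor_id F M) -!sF2_nat !scompA.
  rewrite -!(scompA _ (Fm _) (Fm _)) -!sfmor_comp DA sfmor_id; congr (_ ⊚ _).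
  exact: sF2_coassoc.
- rewrite sidr_comp !scompA -(scompA _ (Fm e ∥ sid _)) -(sfmor_id F M) -sF2_nat.
  by rewrite !scompA -scompA -sfmor_comp De sfmor_id scompm1 sF2_counitl.
rewrite sidl_comp !scompA -(scompA _ (sid _ ∥ Fm e)) -(sfmor_id F M) -sF2_nat.
by rewrite !scompA -scompA -sfmor_comp eD sfmor_id scompm1 sF2_counitr.
Qed.

Lemma sfmor_mor M D e N D' e' (f : shom M N) : is_scmor D e D' e' f ->
  is_scmor (sfcomul D) (sfcounit e) (sfcomul D') (sfcounit e') (Fm f).
Proof.
rewrite /sfcomul /sfcounit => -[fD fe]; split.
  by rewrite scompA -sF2_nat -!scompA -!sfmor_comp fD.
by rewrite -scompA -sfmor_comp fe.
Qed.

(** Here [sfcomul] of the identity is [F2 sunit sunit], and splitting [F0 ∥ F0] into two steps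
    reduces the claim to the left counit law of the functor. *)
Lemma sF0_mor :
  is_scmor (sfcomul (sid sunit : shom sunit (sunit • sunit)))
    (sfcounit (sid sunit)) (sid sunit : shom sunit (sunit • sunit))
    (sid sunit) F0.
Proof.
rewrite /sfcomul /sfcounit sfmor_id !scompm1; split; last by rewrite scomp1m.
rewrite (scomp1m F0).
have -> : F0 ∥ F0 = (sid sunit ∥ F0) ⊚ (F0 ∥ sid (Fo sunit)).
  by smerge; rewrite scomp1m scompm1.
by rewrite -scompA (sF2_counitl F sunit) scompm1 stens1m.
Qed.

(** Coassociativity, arranged so that [F2 Q R] is isolated on the two middle factors, where a
    crossing can be moved through it. *)
Lemma sF2_four P Q R S :
  (F2 P Q ∥ F2 R S) ⊚ F2 (P • Q) (R • S)
  = (sid (Fo P) ∥ ((F2 Q R ∥ sid (Fo S)) ⊚ F2 (Q • R) S))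
      ⊚ F2 P (Q • R • S).
Proof.
have -> : F2 P Q ∥ F2 R S =
    (F2 P Q ∥ sid (Fo R • Fo S)) ⊚ (sid (Fo (P • Q)) ∥ F2 R S).
  by smerge; rewrite scomp1m scompm1.
rewrite -scompA sF2_coassoc -stensm_id scompA.
have -> : F2 P Q ∥ (sid (Fo R) ∥ sid (Fo S)) = F2 P Q ∥ sid (Fo R) ∥ sid (Fo S).
  by sassoc.
smerge; rewrite scomp1m -sF2_coassoc sidr_comp sidl_comp.
have -> : sid (Fo P) ∥ F2 Q R ∥ sid (Fo S) = sid (Fo P) ∥ (F2 Q R ∥ sid (Fo S)).
  by sassoc.
rewrite -!scompA; congr (_ ⊚ _); exact: esym (sF2_coassoc F P (Q • R) S).
Qed.

(** The essential point is [sF2_braid], applied to the two middle ones of the four factors exposed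
    by [sF2_four]. *)
Lemma sF2_mor M D e N D' e' :
  is_scmor (sfcomul (@stcomul _ _ M N D D')) (sfcounit (stcounit e e'))
    (stcomul (sfcomul D) (sfcomul D')) (stcounit (sfcounit e) (sfcounit e'))
    (F2 M N).
Proof.
rewrite /sfcomul /sfcounit /stcomul /stcounit; split; last first.
  rewrite (stensm_comp F0 (Fm e) F0 (Fm e')) -scompA -sF2_nat scompA.
  by have [] := sF0_mor; rewrite /sfcomul sfmor_id scompm1 (scomp1m F0) => ->.
rewrite (stensm_comp (F2 M M) (Fm D) (F2 N N) (Fm D')).
rewrite -!scompA -sF2_nat sfmor_comp !scompA; congr (_ ⊚ _).
rewrite sF2_four -!scompA sF2_four.
have -> : sid M ∥ sbraid M N ∥ sid N = sid M ∥ (sbraid M N ∥ sid N) by sassoc.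
rewrite (sF2_nat F (sid M) (sbraid M N ∥ sid N)) sfmor_id !scompA.
congr (_ ⊚ _).
have -> : sid (Fo M) ∥ sbraid (Fo M) (Fo N) ∥ sid (Fo N) =
    sid (Fo M) ∥ (sbraid (Fo M) (Fo N) ∥ sid (Fo N)) by sassoc.
have key : (F2 N M ∥ sid (Fo N)) ⊚ F2 (N • M) N ⊚ Fm (sbraid M N ∥ sid N) =
    (sbraid (Fo M) (Fo N) ∥ sid (Fo N))
      ⊚ ((F2 M N ∥ sid (Fo N)) ⊚ F2 (M • N) N).
  rewrite -scompA (sF2_nat F (sbraid M N) (sid N)) sfmor_id !scompA.
  by congr (_ ⊚ _); smerge; rewrite sF2_braid.
by smerge; rewrite key.
Qed.

(** * The maps gamma and the multiplication *)

Definition sgamma M (D : shom M (M • M)) X Y :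
    shom (Fo (X • M • Y)) (Fo (X • M) • Fo (M • Y)) :=
  F2 (X • M) (M • Y) ⊚ Fm (sid X ∥ D ∥ sid Y).

(** The argument [g] stands for the inverse of [sgamma]; the lemmas impose this through
    [sinverse]. *)
Definition smul M (e : shom M sunit) X Y
    (g : shom (Fo (X • M) • Fo (M • Y)) (Fo (X • M • Y))) :
    shom (Fo (X • M) • Fo (M • Y)) (Fo (X • Y)) :=
  Fm (sid X ∥ e ∥ sid Y) ⊚ g.

(** The two comultiplications act on disjoint factors and commute; what remains is the
    coassociativity of [F2]. *)
Lemma sgamma_coassoc M (D : shom M (M • M)) N (D' : shom N (N • N)) X Y :
  (sgamma D X N ∥ sid (Fo (N • Y))) ⊚ sgamma D' (X • M) Y
  = (sid (Fo (X • M)) ∥ sgamma D' M Y) ⊚ sgamma D X (N • Y).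
Proof.
rewrite /sgamma sidl_comp sidr_comp -!scompA.
rewrite (scompA (Fm _ ∥ _)) (scompA (_ ∥ Fm _)) -!(sfmor_id F) -!sF2_nat.
rewrite sfmor_id.
rewrite -!scompA -!sfmor_comp !scompA sfmor_id sF2_coassoc.
congr (_ ⊚ Fm _).
have -> : sid X ∥ D ∥ sid N ∥ sid (N • Y) = (sid X ∥ D) ∥ sid (N • N • Y).
  by rewrite -!stensm_id; sassoc.
have -> : sid (X • M) ∥ D' ∥ sid Y = sid (X • M) ∥ (D' ∥ sid Y) by sassoc.
have -> : sid (X • M) ∥ (sid M ∥ D' ∥ sid Y) = sid (X • (M • M)) ∥ (D' ∥ sid Y).
  by rewrite -!stensm_id; sassoc.
by smerge; rewrite !scomp1m !scompm1.
Qed.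

Lemma sgamma_natl M (D : shom M (M • M)) X X' Y (f : shom X X') :
  sgamma D X' Y ⊚ Fm (f ∥ sid M ∥ sid Y)
  = (Fm (f ∥ sid M) ∥ sid (Fo (M • Y))) ⊚ sgamma D X Y.
Proof.
rewrite /sgamma scompA -(sfmor_id F) -sF2_nat -!scompA -!sfmor_comp.
congr (_ ⊚ Fm _).
have -> : f ∥ sid M ∥ sid (M • Y) = f ∥ sid (M • M) ∥ sid Y.
  by rewrite -!stensm_id; sassoc.
by smerge; rewrite !scomp1m !scompm1.
Qed.

Lemma sgamma_natr M (D : shom M (M • M)) X Y Y' (f : shom Y Y') :
  sgamma D X Y' ⊚ Fm (sid X ∥ sid M ∥ f)
  = (sid (Fo (X • M)) ∥ Fm (sid M ∥ f)) ⊚ sgamma D X Y.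
Proof.
rewrite /sgamma scompA -(sfmor_id F) -sF2_nat -!scompA -!sfmor_comp.
congr (_ ⊚ Fm _).
have -> : sid (X • M) ∥ (sid M ∥ f) = sid X ∥ sid (M • M) ∥ f.
  by rewrite -!stensm_id; sassoc.
by smerge; rewrite !scomp1m !scompm1.
Qed.

Lemma smul_gamma M (D : shom M (M • M)) e X Y g (P : sobj B) (f : shom P _) :
  sinverse (sgamma D X Y) g ->
  smul e g ⊚ (sgamma D X Y ⊚ f) = Fm (sid X ∥ e ∥ sid Y) ⊚ f.
Proof. by case=> gK _; rewrite /smul -scompA (scompA g) gK scomp1m. Qed.

(** * Associativity of the multiplication *)

Section Composition.
Context X M N Y (D : shom M (M • M)) (e : shom M sunit)
  (D' : shom N (N • N)) (e' : shom N sunit)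
  g1 (g1P : sinverse (sgamma D X N) g1)
  g2 (g2P : sinverse (sgamma D' M Y) g2)
  g3 (g3P : sinverse (sgamma D' X Y) g3)
  g4 (g4P : sinverse (sgamma D X Y) g4)
  g5 (g5P : sinverse (sgamma D' (X • M) Y) g5).

Lemma smul_assoc :
  smul e' g3 ⊚ (smul e g1 ∥ sid (Fo (N • Y)))
  = smul e g4 ⊚ (sid (Fo (X • M)) ∥ smul e' g2).
Proof.
(* [T] splits the fourfold product at both [M] and [N]. The inverses [g5] and [g1] give it a right
   inverse, so the two sides may be compared after composing with [T], where their own inverses
   cancel. *)
pose T := (sgamma D X N ∥ sid (Fo (N • Y))) ⊚ sgamma D' (X • M) Y.
have TK : T ⊚ (g5 ⊚ (g1 ∥ sid (Fo (N • Y)))) = sid _.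
  rewrite /T -scompA (scompA (sgamma D' _ _) g5) g5P.2 scomp1m.
  by smerge; rewrite g1P.2 scomp1m stensm_id.
suff ET : smul e' g3 ⊚ (smul e g1 ∥ sid (Fo (N • Y))) ⊚ T
    = smul e g4 ⊚ (sid (Fo (X • M)) ∥ smul e' g2) ⊚ T.
  by rewrite -[LHS]scompm1 -[RHS]scompm1 -TK !(scompA _ T) ET.
have El : (smul e g1 ∥ sid (Fo (N • Y))) ⊚ T =
    sgamma D' X Y ⊚ Fm (sid X ∥ e ∥ sid N ∥ sid Y).
  rewrite /T scompA; smerge; rewrite /smul -scompA g1P.1 scompm1 scomp1m.
  (* The codomain [X • sunit] of [sid X ∥ e] is [X] by conversion. *)
  exact/esym/(sgamma_natl D' Y (sid X ∥ e : shom _ X)).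
have Er : (sid (Fo (X • M)) ∥ smul e' g2) ⊚ T =
    sgamma D X Y ⊚ Fm (sid X ∥ sid M ∥ (e' ∥ sid Y)).
  rewrite /T sgamma_coassoc scompA; smerge.
  rewrite /smul -scompA g2P.1 !scompm1.
  rewrite (sgamma_natr D X (e' ∥ sid Y)).
  have -> : sid M ∥ (e' ∥ sid Y) = sid M ∥ e' ∥ sid Y by sassoc.
  by [].
rewrite -scompA El -scompA Er !smul_gamma // -!sfmor_comp; congr (Fm _).
have -> : sid X ∥ e ∥ sid N ∥ sid Y = (sid X ∥ e) ∥ sid (N • Y).
  by rewrite -!stensm_id; sassoc.
have -> : sid X ∥ e' ∥ sid Y = sid X ∥ (e' ∥ sid Y) by sassoc.
by rewrite stensm_id; smerge; rewrite !scomp1m !scompm1.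
Qed.

End Composition.

(** * Unit laws *)

Section Units.
Context M (D : shom M (M • M)) (e : shom M sunit) (MP : is_scomonoid D e)
  (c : shom sunit (Fo M)) (cP : sinverse (sfcounit e) c) (X : sobj C).

(** By the counit laws of [M] and of the functor the left side is a right inverse of
    [sfcounit e ∥ sid (Fo (M • X))], while the right side is a left inverse of it; hence they
    agree. *)
Lemma sF2_comull :
  F2 M (M • X) ⊚ Fm (D ∥ sid X) = c ∥ sid (Fo (M • X)).
Proof.
have [_ De _] := MP; have [cK _] := cP.
have key : (sfcounit e ∥ sid (Fo (M • X))) ⊚ (F2 M (M • X) ⊚ Fm (D ∥ sid X))
    = sid (Fo (M • X)).
  rewrite /sfcounit sidr_comp -(sfmor_id F) -scompA (scompA (Fm e ∥ _)).
  rewrite -sF2_nat.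
  rewrite sfmor_id -!scompA -sfmor_comp -stensm_id.
  have -> : e ∥ (sid M ∥ sid X) = e ∥ sid M ∥ sid X by sassoc.
  smerge; rewrite De scomp1m stensm_id sfmor_id scompm1.
  exact: (sF2_counitl F (M • X)).
have E : (c ∥ sid (Fo (M • X))) ⊚ (sfcounit e ∥ sid (Fo (M • X)))
    = sid (Fo M • Fo (M • X)).
  by smerge; rewrite cK scomp1m stensm_id.
by rewrite -[LHS]scomp1m -E -scompA key scompm1.
Qed.

Lemma sF2_comulr :
  F2 (X • M) M ⊚ Fm (sid X ∥ D) = sid (Fo (X • M)) ∥ c.
Proof.
have [_ _ eD] := MP; have [cK _] := cP.
have key : (sid (Fo (X • M)) ∥ sfcounit e) ⊚ (F2 (X • M) M ⊚ Fm (sid X ∥ D))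
    = sid (Fo (X • M)).
  rewrite /sfcounit sidl_comp -(sfmor_id F) -scompA (scompA (_ ∥ Fm e)).
  rewrite -sF2_nat.
  rewrite sfmor_id -!scompA -sfmor_comp -stensm_id.
  have -> : sid X ∥ sid M ∥ e = sid X ∥ (sid M ∥ e) by sassoc.
  smerge; rewrite eD scomp1m stensm_id sfmor_id scompm1.
  exact: (sF2_counitr F (X • M)).
have E : (sid (Fo (X • M)) ∥ c) ⊚ (sid (Fo (X • M)) ∥ sfcounit e)
    = sid (Fo (X • M) • Fo M).
  by smerge; rewrite cK scomp1m stensm_id.
by rewrite -[LHS]scomp1m -E -scompA key scompm1.
Qed.

Lemma smul_unitl g : sinverse (sgamma D M X) g ->
  smul e g ⊚ ((Fm D ⊚ c) ∥ sid (Fo (M • X))) = sid (Fo (M • X)).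
Proof.
have [DA _ eD] := MP.
move=> gP; rewrite sidr_comp -sF2_comull (scompA (Fm D ∥ _)) -(sfmor_id F).
rewrite -sF2_nat -scompA -sfmor_comp.
(* Coassociativity puts the outer comultiplication on the middle factor, which makes [sgamma] appear
   for [smul] to cancel. *)
have -> : (D ∥ sid (M • X)) ⊚ (D ∥ sid X) = (sid M ∥ D ∥ sid X) ⊚ (D ∥ sid X).
  rewrite -stensm_id.
  have -> : D ∥ (sid M ∥ sid X) = D ∥ sid M ∥ sid X by sassoc.
  by smerge; rewrite DA.
rewrite sfmor_comp (scompA (F2 _ _)) (smul_gamma e (Fm (D ∥ sid X)) gP).
rewrite -sfmor_comp.
by smerge; rewrite eD scomp1m stensm_id sfmor_id.
Qed.

Lemma smul_unitr g : sinverse (sgamma D X M) g ->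
  smul e g ⊚ (sid (Fo (X • M)) ∥ (Fm D ⊚ c)) = sid (Fo (X • M)).
Proof.
have [DA De _] := MP.
move=> gP; rewrite sidl_comp -sF2_comulr (scompA (_ ∥ Fm D)) -(sfmor_id F).
rewrite -sF2_nat -scompA -sfmor_comp.
have -> : (sid (X • M) ∥ D) ⊚ (sid X ∥ D) = (sid X ∥ D ∥ sid M) ⊚ (sid X ∥ D).
  rewrite -stensm_id.
  have -> : sid X ∥ sid M ∥ D = sid X ∥ (sid M ∥ D) by sassoc.
  have -> : sid X ∥ D ∥ sid M = sid X ∥ (D ∥ sid M) by sassoc.
  by smerge; rewrite DA.
rewrite sfmor_comp (scompA (F2 _ _)) (smul_gamma e (Fm (sid X ∥ D)) gP).
rewrite -sfmor_comp.
have -> : sid X ∥ e ∥ sid M = sid X ∥ (e ∥ sid M) by sassoc.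
by smerge; rewrite De scomp1m stensm_id sfmor_id.
Qed.

End Units.

(** Factors the counit through chi of [M] alone, so that the inverse of chi cancels in the antipode
    law. *)
Lemma sfcounit_stcounitl M (e : shom M sunit) N (e' : shom N sunit) :
  sfcounit (stcounit e e') = sfcounit e ⊚ Fm (sid M ∥ e').
Proof.
rewrite /sfcounit -scompA -sfmor_comp; congr (_ ⊚ Fm _).
by rewrite /stcounit -[in RHS](stensm1 e); smerge; rewrite scomp1m scompm1.
Qed.

Lemma sfcounit_stcounitr M (e : shom M sunit) N (e' : shom N sunit) :
  sfcounit (stcounit e e') = sfcounit e' ⊚ Fm (e ∥ sid N).
Proof.
rewrite /sfcounit -scompA -sfmor_comp; congr (_ ⊚ Fm _).
by rewrite /stcounit -[in RHS](stens1m e'); smerge; rewrite scomp1m scompm1.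
Qed.

(** * Antipode laws *)

Section Antipode.
Context M (D : shom M (M • M)) (e : shom M sunit)
  N (D' : shom N (N • N)) (e' : shom N sunit).

Lemma smul_antipoder g c : sinverse (sgamma D' M M) g ->
  sinverse (sfcounit e) c ->
  smul e' g ⊚ (sid (Fo (M • N)) ∥ Fm (sbraid M N)) ⊚ sfcomul (stcomul D D')
  = (Fm D ⊚ c) ⊚ sfcounit (stcounit e e').
Proof.
move=> gP [cK _].
(* The hexagon merges the crossings of [M] with the two copies of [N] into one crossing with
   [N • N], through which [D'] slides. It then sits in the middle, as in [sgamma D' M M]. *)
have key : (sid (M • N) ∥ sbraid M N) ⊚ stcomul D D' =
    (sid M ∥ D' ∥ sid M) ⊚ ((sid M ∥ sbraid M N) ⊚ (D ∥ sid N)).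
  rewrite /stcomul scompA.
  have -> : sid (M • N) ∥ sbraid M N = sid M ∥ (sid N ∥ sbraid M N).
    by rewrite -stensm_id; sassoc.
  have -> : sid M ∥ sbraid M N ∥ sid N = sid M ∥ (sbraid M N ∥ sid N) by sassoc.
  have -> : sid M ∥ D' ∥ sid M = sid M ∥ (D' ∥ sid M) by sassoc.
  rewrite [in RHS]scompA; smerge.
  rewrite -sbraid_hexr sbraid_nat !scomp1m sidl_comp.
  rewrite -scompA; have -> : sid M ∥ (sid M ∥ D') = sid (M • M) ∥ D'.
    by rewrite -stensm_id; sassoc.
  by smerge; rewrite !scomp1m scompm1.
rewrite -scompA {1}/sfcomul (scompA (_ ∥ _)) -(sfmor_id F) -sF2_nat -scompA.
rewrite -sfmor_comp key sfmor_comp (scompA (F2 _ _)).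
rewrite (smul_gamma e' (Fm ((sid M ∥ sbraid M N) ⊚ (D ∥ sid N))) gP).
rewrite -sfmor_comp.
(* Sliding [e'] through the crossing leaves a braiding with the unit, which is an identity. *)
have -> : (sid M ∥ e' ∥ sid M) ⊚ ((sid M ∥ sbraid M N) ⊚ (D ∥ sid N))
    = D ⊚ (sid M ∥ e').
  have -> : sid M ∥ e' ∥ sid M = sid M ∥ (e' ∥ sid M) by sassoc.
  rewrite scompA; smerge; rewrite sbraid_nat sbraid_sunitr !scomp1m.
  have -> : sid M ∥ (sid M ∥ e') = sid (M • M) ∥ e'.
    by rewrite -stensm_id; sassoc.
  rewrite -[in RHS](stensm1 D).
  by smerge; rewrite !scomp1m !scompm1.
by rewrite sfmor_comp -scompA (sfcounit_stcounitl e e') (scompA c) cK scomp1m.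
Qed.

Lemma smul_antipodel g c : sinverse (sgamma D N N) g ->
  sinverse (sfcounit e') c ->
  smul e g ⊚ (Fm (sbraid M N) ∥ sid (Fo (M • N))) ⊚ sfcomul (stcomul D D')
  = (Fm D' ⊚ c) ⊚ sfcounit (stcounit e e').
Proof.
move=> gP [cK _].
have key : (sbraid M N ∥ sid (M • N)) ⊚ stcomul D D' =
    (sid N ∥ D ∥ sid N) ⊚ ((sbraid M N ∥ sid N) ⊚ (sid M ∥ D')).
  rewrite /stcomul !scompA.
  have -> : sbraid M N ∥ sid (M • N) = (sbraid M N ∥ sid M) ∥ sid N.
    by rewrite -stensm_id; sassoc.
  smerge; rewrite -sbraid_hexl sbraid_nat !scomp1m sidr_comp.
  rewrite -scompA; have -> : D ∥ sid N ∥ sid N = D ∥ sid (N • N).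
    by rewrite -stensm_id; sassoc.
  by smerge; rewrite !scomp1m scompm1.
rewrite -scompA {1}/sfcomul (scompA (_ ∥ _)) -(sfmor_id F) -sF2_nat -scompA.
rewrite -sfmor_comp key sfmor_comp (scompA (F2 _ _)).
rewrite (smul_gamma e (Fm ((sbraid M N ∥ sid N) ⊚ (sid M ∥ D'))) gP).
rewrite -sfmor_comp.
have -> : (sid N ∥ e ∥ sid N) ⊚ ((sbraid M N ∥ sid N) ⊚ (sid M ∥ D'))
    = D' ⊚ (e ∥ sid N).
  rewrite scompA; smerge; rewrite sbraid_nat sbraid_sunitl !scomp1m.
  have -> : e ∥ sid N ∥ sid N = e ∥ sid (N • N) by rewrite -stensm_id; sassoc.
  rewrite -[in RHS](stens1m D').
  by smerge; rewrite !scomp1m !scompm1.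
by rewrite sfmor_comp -scompA (sfcounit_stcounitr e e') (scompA c) cK scomp1m.
Qed.

End Antipode.

(** * The multiplication and the unit as comonoid morphisms *)

Section Morphisms.
Context M (D : shom M (M • M)) (e : shom M sunit) (MP : is_scomonoid D e)
  (DC : sbraid M M ⊚ D = D).

Lemma sgamma_mor X (DX : shom X (X • X)) (eX : shom X sunit)
    Y (DY : shom Y (Y • Y)) (eY : shom Y sunit) :
  is_scmor (sfcomul (stcomul (stcomul DX D) DY))
    (sfcounit (stcounit (stcounit eX e) eY))
    (stcomul (sfcomul (stcomul DX D)) (sfcomul (stcomul D DY)))
    (stcounit (sfcounit (stcounit eX e)) (sfcounit (stcounit e eY)))
    (sgamma D X Y).
Proof.
apply: scmor_comp (sF2_mor _ _ _ _) _; apply: sfmor_mor.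
(* Regrouping the four factors as [X], [M • M], [Y] exhibits [sid X ∥ D ∥ sid Y] as a tensor product
   of comonoid morphisms. *)
rewrite (stcomul_assoc (stcomul DX D)) -(stcomul_assoc DX D D).
have -> : stcounit (stcounit eX e) (stcounit e eY)
    = stcounit (stcounit eX (stcounit e e)) eY.
  by rewrite /stcounit; sassoc.
have DP := scomul_mor MP DC.
exact: (stcomul_mor (stcomul_mor (scmor_id DX eX) DP) (scmor_id DY eY)).
Qed.

Lemma smul_mor X (DX : shom X (X • X)) (eX : shom X sunit)
    Y (DY : shom Y (Y • Y)) (eY : shom Y sunit) g : sinverse (sgamma D X Y) g ->
  is_scmor (stcomul (sfcomul (stcomul DX D)) (sfcomul (stcomul D DY)))
    (stcounit (sfcounit (stcounit eX e)) (sfcounit (stcounit e eY)))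
    (sfcomul (stcomul DX DY)) (sfcounit (stcounit eX eY)) (smul e g).
Proof.
move=> [gK Kg].
apply: (@scmor_comp _ _ _ _ _ _ (sfcomul (stcomul (stcomul DX D) DY))
  (sfcounit (stcounit (stcounit eX e) eY))).
  apply: sfmor_mor; have eP := scounit_mor MP.
  have := stcomul_mor (stcomul_mor (scmor_id DX eX) eP) (scmor_id DY eY).
  by rewrite stcomul_unitr /stcounit stensm1.
exact: (scmor_inv gK Kg (sgamma_mor _ _ _ _)).
Qed.

(** Chi is the composite of the comonoid morphisms [Fm e] and [F0], so its inverse [c] is one as
    well, and so is [Fm D] by cocommutativity. *)
Lemma sunit_mor c : sinverse (sfcounit e) c ->
  is_scmor (sid sunit : shom sunit (sunit • sunit)) (sid sunit)
    (sfcomul (stcomul D D)) (sfcounit (stcounit e e)) (Fm D ⊚ c).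
Proof.
move=> [cK Kc]; apply: (@scmor_comp _ _ _ _ _ _ (sfcomul D) (sfcounit e)).
  exact/sfmor_mor/scomul_mor.
apply: (scmor_inv cK Kc); apply: scmor_comp sF0_mor _.
exact/sfmor_mor/scounit_mor.
Qed.

End Morphisms.

End StrictHopf.

Lemma minvP K (C : linCat K) (X Y : C) (f : X ~> Y) :
  invertible f -> is_inverse f (minv f).
Proof. by move=> [g fg]; apply: (xgetPex 0); exists g. Qed.

(** * Transfer from the strictification *)

Section Transfer.
Context {K : fieldType} {C : monCat K}.
Implicit Types (P Q : sobj C) (X Y : C).

Lemma sheq_sinverse P Q (f : shom P Q) X Y (f' : X ~> Y) (g' : Y ~> X) :
  sheq f f' -> is_inverse f' g' ->
  sinverse f (recast g') /\ sheq (recast g' : shom Q P) g'.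
Proof.
move=> ff' [gf fg]; have [e [e' _]] := ff'.
have gg' : sheq (recast g' : shom Q P) g' by apply: heq_recast.
split=> //; split.
  by apply: sheqP (sheq_scomp gg' ff') _; rewrite gf; exact: sheq_sid.
by apply: sheqP (sheq_scomp ff' gg') _; rewrite fg; exact: sheq_sid.
Qed.

(** Read from right to left for the given comonoids, and from left to right for the comonoids
    [A x y]. *)
Lemma scomonoidP M (D : shom M (M • M)) (e : shom M sunit) (N : C)
    (D' : N ~> N ⊗ N) (e' : N ~> munit) :
  sheq D D' -> sheq e e' -> is_scomonoid D e <-> is_comonoid D' e'.
Proof.
move=> DD' ee'.
have i : sheq (sid M) (idm N) by apply/sheq_sid/(sheq_dom DD').
rewrite /is_comonoid /is_scomonoid /assoc /lunit /runit.
have a : sheq ((sid M ∥ D) ⊚ D) (idto (tensA N N N) ∘ (idm N ⊠ D') ∘ D').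
  by apply: sheq_scomp => //; apply/sheq_idtol/sheq_stensm.
have b : sheq ((D ∥ sid M) ⊚ D) ((D' ⊠ idm N) ∘ D').
  by apply: sheq_scomp => //; apply/sheq_stensm.
have c : sheq ((e ∥ sid M) ⊚ D) (idto (tens1X N) ∘ (e' ⊠ idm N) ∘ D').
  by apply: sheq_scomp => //; apply/sheq_idtol/sheq_stensm.
have d : sheq ((sid M ∥ e) ⊚ D) (idto (tensX1 N) ∘ (idm N ⊠ e') ∘ D').
  by apply: sheq_scomp => //; apply/sheq_idtol/sheq_stensm.
split=> -[E1 E2 E3]; split.
- by apply: sheq_eq a _; rewrite E1.
- by apply: sheq_eq c _; rewrite E2.
- by apply: sheq_eq d _; rewrite E3.
- by apply: sheqP a _; rewrite E1.
- by apply: sheqP c _; rewrite E2.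
- by apply: sheqP d _; rewrite E3.
Qed.

Lemma scmorP M (D : shom M (M • M)) e N (D' : shom N (N • N)) e' (f : shom M N)
    X (d : X ~> X ⊗ X) (c : X ~> munit) Y (d' : Y ~> Y ⊗ Y) (c' : Y ~> munit)
    (g : X ~> Y) :
  sheq D d -> sheq e c -> sheq D' d' -> sheq e' c' -> sheq f g ->
  is_scmor D e D' e' f -> is_comonoid_morphism d c d' c' g.
Proof.
move=> Dd ec Dd' ec' fg [fD fe]; split.
  apply: sheq_eq (sheq_scomp (sheq_stensm fg fg) Dd) _.
  by rewrite fD; exact: sheq_scomp.
by apply: sheq_eq (sheq_scomp ec' fg) _; rewrite fe.
Qed.

End Transfer.

Section TransferTensor.
Context {K : fieldType} {C : symCat K}.

Lemma sheq_stcomul (M N : sobj C) D D' (X Y : C)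
    (d : X ~> X ⊗ X) (d' : Y ~> Y ⊗ Y) :
  sheq D d -> sheq D' d' -> sheq (@stcomul _ _ M N D D') (tens_comul d d').
Proof.
move=> Dd Dd'; have [e e'] := (sheq_dom Dd, sheq_dom Dd').
have s := sheq_stensm (sheq_stensm (sheq_sid e) (sheq_sbraid e e'))
  (sheq_sid e').
by apply: sheq_scomp (sheq_stensm Dd Dd'); apply/sheq_idtor/sheq_idtol/s.
Qed.

Lemma sheq_stcounit (M N : sobj C) e e' (X Y : C)
    (c : X ~> munit) (c' : Y ~> munit) :
  sheq e c -> sheq e' c' -> sheq (@stcounit _ _ M N e e') (tens_counit c c').
Proof. by move=> ec ec'; have s := sheq_stensm ec ec'; exact/sheq_idtol/s. Qed.

End TransferTensor.

(** * The Hopf category of cocommutative adapted comonoids in symmetric categories *)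

Section HopfOfComonoids.
Context {K : fieldType} {C B : symCat K} (F : brComonFunctor C B).
Context (I : Type) (M : I -> comonoid C).
Context (Mcocomm : forall x, braid (M x) (M x) ∘ comul (M x) = comul (M x)).
Context (Madapted : forall x, adapted F (M x)).

Local Notation Fo := (sfobj F).
Local Notation Fm := (sfmor F).

Let o x : sobj C := emb (M x).
Let D x : shom (o x) (o x • o x) := recast (comul (M x)).
Let e x : shom (o x) sunit := recast (counit (M x)).

(** Only propositional, because the left side computes to [M x ⊗ munit]; the comparisons with the
    strictification therefore take such equalities as arguments. *)
Let ox x : sfn (o x) munit = M x.
Proof. exact: sfn_emb. Qed.

Let sheq_D x : sheq (D x) (comul (M x)).
Proof. by apply: heq_recast; rewrite ?ox // (sfn_stens (ox x) (ox x)). Qed.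

Let sheq_e x : sheq (e x) (counit (M x)).
Proof. by apply: heq_recast; rewrite ?ox. Qed.

Let Dcom x : is_scomonoid (D x) (e x).
Proof. exact/(scomonoidP (sheq_D x) (sheq_e x))/comonoidP. Qed.

Let Dcocomm x : sbraid (o x) (o x) ⊚ D x = D x.
Proof.
apply: sheqP (sheq_scomp (sheq_sbraid (ox x) (ox x)) (sheq_D x)) _.
by rewrite Mcocomm.
Qed.

Let sheq_gamma x (P Q : sobj C) (X Y : C) :
  sfn P munit = X -> sfn Q munit = Y ->
  sheq (sgamma F (D x) P Q) (gamma F (M x) X Y).
Proof.
move=> PX QY; apply: sheq_scomp.
  exact: sheq_sF2 (sfn_stens PX (ox x)) (sfn_stens (ox x) QY).
have s := sheq_stensm (sheq_stensm (sheq_sid PX) (sheq_D x)) (sheq_sid QY).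
exact/sheq_sfmor/sheq_idtol/s.
Qed.

(** [P] and [Q] range over all objects, since associativity also inverts gamma at the product
    [o x • o y]. *)
Let g x (P Q : sobj C) :
    shom (Fo (P • o x) • Fo (o x • Q)) (Fo (P • o x • Q)) :=
  recast (minv (gamma F (M x) (sfn P munit) (sfn Q munit))).

Let gP x (P Q : sobj C) : sinverse (sgamma F (D x) P Q) (g x P Q).
Proof.
have [_ /(_ (sfn P munit) (sfn Q munit))/minvP h] := Madapted x.
exact: (sheq_sinverse (sheq_gamma x erefl erefl) h).1.
Qed.

Let sheq_g x (P Q : sobj C) (X Y : C) : sfn P munit = X -> sfn Q munit = Y ->
  sheq (g x P Q) (minv (gamma F (M x) X Y)).
Proof.
move=> <- <-; have [_ /(_ (sfn P munit) (sfn Q munit))/minvP h] := Madapted x.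
exact: (sheq_sinverse (sheq_gamma x erefl erefl) h).2.
Qed.

Let sheq_chi x : sheq (sfcounit F (e x)) (chi F (M x)).
Proof. exact: sheq_scomp (sheq_sF0 F) (sheq_sfmor F (sheq_e x)). Qed.

Let c x : shom sunit (Fo (o x)) := recast (minv (chi F (M x))).

Let cP x : sinverse (sfcounit F (e x)) (c x).
Proof.
have [/minvP h _] := Madapted x; exact: (sheq_sinverse (sheq_chi x) h).1.
Qed.

Let sheq_c x : sheq (c x) (minv (chi F (M x))).
Proof.
have [/minvP h _] := Madapted x; exact: (sheq_sinverse (sheq_chi x) h).2.
Qed.

Let A x y : B := F (M x ⊗ M y).
Let Delta x y : A x y ~> A x y ⊗ A x y :=
  F2 F (M x ⊗ M y) (M x ⊗ M y) ∘ fmor F (id_braid_id (M x) (M y))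
    ∘ fmor F (comul (M x) ⊠ comul (M y)).
Let eps x y : A x y ~> munit :=
  F0 F ∘ fmor F (tens_counit (counit (M x)) (counit (M y))).
Let m x y z : A x y ⊗ A y z ~> A x z :=
  fmor F (id_counit_id (M x) (counit (M y)) (M z))
    ∘ minv (gamma F (M y) (M x) (M z)).
Let u x : munit ~> A x x := fmor F (comul (M x)) ∘ minv (chi F (M x)).
Let S x y : A x y ~> A y x := fmor F (braid (M x) (M y)).

Let sheq_Delta x y : sheq (sfcomul F (stcomul (D x) (D y))) (Delta x y).
Proof.
rewrite /Delta -mcompA -fmor_comp; apply: sheq_scomp.
  exact: sheq_sF2 (sfn_stens (ox x) (ox y)) (sfn_stens (ox x) (ox y)).
by apply: sheq_sfmor; exact: sheq_stcomul.
Qed.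

Let sheq_eps x y : sheq (sfcounit F (stcounit (e x) (e y))) (eps x y).
Proof. by apply: sheq_scomp (sheq_sF0 F) _; apply/sheq_sfmor/sheq_stcounit. Qed.

Let sheq_m x y z : sheq (smul (e y) (g y (o x) (o z))) (m x y z).
Proof.
have s := sheq_stensm (sheq_stensm (sheq_sid (ox x)) (sheq_e y))
  (sheq_sid (ox z)).
by apply: sheq_scomp (sheq_g y (ox x) (ox z)); apply/sheq_sfmor/sheq_idtol/s.
Qed.

Let sheq_u x : sheq (Fm (D x) ⊚ c x) (u x).
Proof. exact: sheq_scomp (sheq_sfmor F (sheq_D x)) (sheq_c x). Qed.

Let sheq_S x y : sheq (Fm (sbraid (o x) (o y))) (S x y).
Proof. exact/sheq_sfmor/sheq_sbraid. Qed.

Let sheq_A x y : sheq (sid (Fo (o x • o y))) (idm (A x y)).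
Proof. exact/sheq_sid/sfn_sfobj/(sfn_stens (ox x) (ox y)). Qed.

(** Each operation corresponds under [sheq] to its strict counterpart, so each axiom follows from
    the strict one. *)
Lemma comonoids_hopf_category : is_hopf_category Delta eps m u S.
Proof.
split.
- split=> [x y z w|x y|x y].
  + have l := sheq_scomp (sheq_m x z w)
      (sheq_stensm (sheq_m x y z) (sheq_A z w)).
    have r := sheq_scomp (sheq_m x y w)
      (sheq_stensm (sheq_A x y) (sheq_m y z w)).
    apply: sheq_eq (sheq_idtor _ l) _.
    (* The fifth inverse, that of gamma for [z] at [o x • o y] and [o w], serves to cancel the test
       isomorphism. *)
    by rewrite (smul_assoc _ _ (gP y _ _) (gP z _ _) (gP z _ _) (gP y _ _)
      (gP z _ _)).
  + have l := sheq_scomp (sheq_m x x y) (sheq_stensm (sheq_u x) (sheq_A x y)).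
    apply: sheq_eq (sheq_idtor _ l) _.
    rewrite (smul_unitl (Dcom x) (cP x) (gP x _ _)); exact: sheq_A.
  have r := sheq_scomp (sheq_m x y y) (sheq_stensm (sheq_A x y) (sheq_u y)).
  apply: sheq_eq (sheq_idtor _ r) _.
  rewrite (smul_unitr (Dcom y) (cP y) (gP y _ _)); exact: sheq_A.
- move=> x y; apply/(scomonoidP (sheq_Delta x y) (sheq_eps x y)).
  exact/sfcomul_counit/stcomul_counit.
- move=> x y z.
  apply: scmorP (sheq_stcomul (sheq_Delta x y) (sheq_Delta y z))
    (sheq_stcounit (sheq_eps x y) (sheq_eps y z))
    (sheq_Delta x z) (sheq_eps x z) (sheq_m x y z) _.
  exact: smul_mor.
- move=> x.
  apply: scmorP (sheq_Delta x x) (sheq_eps x x) (sheq_u x) _;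
    last exact: sunit_mor.
    (* The comultiplication [lunitV munit] of the unit object is an identity cast. *)
    exact: heq_idto.
  exact: sheq_refl.
- move=> x y.
  have l := sheq_scomp (sheq_scomp (sheq_m x y x)
    (sheq_stensm (sheq_A x y) (sheq_S x y))) (sheq_Delta x y).
  apply: sheq_eq l _; rewrite (smul_antipoder _ _ (gP y _ _) (cP x)).
  exact: sheq_scomp (sheq_u x) (sheq_eps x y).
move=> x y.
have l := sheq_scomp (sheq_scomp (sheq_m y x y)
  (sheq_stensm (sheq_S x y) (sheq_A x y))) (sheq_Delta x y).
apply: sheq_eq l _; rewrite (smul_antipodel _ _ (gP x _ _) (cP y)).
exact: sheq_scomp (sheq_u y) (sheq_eps x y).
Qed.

End HopfOfComonoids.

(** * Deformed comonoids *)

Section Deformation.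
Context {K : fieldType} (K0 : [pchar K] =i pred0) (C B : symPreCartier K).
Context (tC : infbr_commutes C) (sC : infbr_skew C).
Context (tB : infbr_commutes B) (sB : infbr_skew B).
Context (F : brComonFunctor C B) (tF : inf_braided F).

Local Notation hC := (deform K0 tC sC).
Local Notation hF := (deform_functor K0 tC sC tB sB tF).

Lemma cser_invertible (D : monCat K) (X Y : D) (f : X ~> Y) :
  invertible f -> @invertible K (hat_cat D) X Y (cser f).
Proof.
move=> [g [gf fg]]; exists (cser g); split.
  by transitivity (cser (g ∘ f)); [exact: hat_mcomp_cser | rewrite gf].
by transitivity (cser (f ∘ g)); [exact: hat_mcomp_cser | rewrite fg].
Qed.

Lemma hat_cocomm (M : comonoid C) : inf_cocommutative M ->
  braid (hat_comonoid M : hC) (hat_comonoid M) ∘ comul (hat_comonoid M)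
  = comul (hat_comonoid M) :> (_ ~> (hat_comonoid M : hC) ⊗ hat_comonoid M).
Proof.
move=> [sM tM].
change (hat_comp (hat_braid M M) (cser (comul M)) = cser (comul M)).
apply/funext => n; rewrite hat_mcomp_cserr hat_braidE.
(* [comul M] intertwines the zero endomorphism with [infbr M M], as both composites vanish; hence it
   intertwines their exponentials, and that of 0 is the constant series of the identity. *)
rewrite -mcompA -(exph_comm (t := 0)) ?mcomp0r // exph0.
by case: n => [|n] /=; rewrite ?mcompm1 ?mcomp0r.
Qed.

Lemma hat_adapted (M : comonoid C) : adapted F M ->
  adapted hF (hat_comonoid M : comonoid hC).
Proof.
move=> [chiV gammaV]; split=> [|X Y].
  suff -> : chi hF (hat_comonoid M : comonoid hC) = cser (chi F M).
    exact: (@cser_invertible B _ _ _ chiV).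
  by rewrite /chi /= hat_fmor_cser hat_mcomp_cser.
suff -> : gamma hF (hat_comonoid M : comonoid hC) X Y = cser (gamma F M X Y).
  exact: (@cser_invertible B _ _ _ (gammaV X Y)).
rewrite /gamma /id_comul_id (@hat_idto K C) /=.
rewrite !(hat_tensm_cser, hat_mcomp_cser, hat_fmor_cser).
(* The casts in [C] and in its deformation come from different proofs of one equality of objects. *)
congr (cser (_ ∘ fmor F (_ ∘ _))); exact: idto_irr.
Qed.

End Deformation.

Theorem theorem22 (K : fieldType) (K0 : [pchar K] =i pred0)
    (C B : symPreCartier K)
    (tC : infbr_commutes C) (sC : infbr_skew C)
    (tB : infbr_commutes B) (sB : infbr_skew B)
    (F : brComonFunctor C B) (tF : inf_braided F) :
  let hC : symCat K := deform K0 tC sC in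
  let hB : symCat K := deform K0 tB sB in
  let hF : brComonFunctor hC hB := deform_functor K0 tC sC tB sB tF in
  let A0 : Type := adaptedCom F in
  let hat (x : A0) : comonoid hC := hat_comonoid x in
  let A (x y : A0) : hB := hF (hat x ⊗ hat y) in
  let Delta (x y : A0) : A x y ~> A x y ⊗ A x y :=
    F2 hF (hat x ⊗ hat y) (hat x ⊗ hat y)
      ∘ fmor hF (id_braid_id (hat x) (hat y))
      ∘ fmor hF (comul (hat x) ⊠ comul (hat y)) in
  let eps (x y : A0) : A x y ~> munit :=
    F0 hF ∘ fmor hF (tens_counit (counit (hat x)) (counit (hat y))) in
  let m (x y z : A0) : A x y ⊗ A y z ~> A x z :=
    fmor hF (id_counit_id (hat x) (counit (hat y)) (hat z))
      ∘ minv (gamma hF (hat y) (hat x) (hat z)) in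
  let u (x : A0) : munit ~> A x x :=
    fmor hF (comul (hat x)) ∘ minv (chi hF (hat x)) in
  let S (x y : A0) : A x y ~> A y x := fmor hF (braid (hat x) (hat y)) in
  is_hopf_category Delta eps m u S.
Proof.
(* The family is indexed by [adaptedCom F] and consists of the deformed comonoids, over the deformed
   categories. *)
apply: comonoids_hopf_category => x.
  exact/hat_cocomm/ac_cocomm.
exact/hat_adapted/ac_adapted.
Qed.
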